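(* Let $A\simeq kQ_A/I_A$ be a representation-finite algebra, let $T$ be a separating tilting $A$-module and let $B=\mathrm{End}_A(T)$. Let $r_A$ be the nilpotency index of $\Re(\mathrm{mod}\,A)$, and let $(R_A)_0=\{u\in (Q_A)_0 : r_u=r_A-1\}$, where $r_u$ is the length of any path from $P_u$ to $I_u$ going through $S_u$ (see the context for the precise definition of $r_u$). If $B$ is representation-finite and for some $u\in (R_A)_0$ we have $P_u\in \mathrm{add}\,T$, then $r_A\leq r_B$, where $r_B$ is the nilpotency index of $\Re(\mathrm{mod}\,B)$.
   Context: $k$ is an algebraically closed field; an algebra is a finite dimensional basic $k$-algebra; $\mathrm{mod}\,A$ is the category of finitely generated left $A$-modules. Write $A\simeq kQ_A/I_A$ with $Q_A$ the ordinary quiver and $I_A$ an admissible ideal; $(Q_A)_0$ is its set of vertices. $P_a,I_a,S_a$ are the indecomposable projective, the indecomposable injective and the simple $A$-module at the vertex $a$. $\mathrm{add}\,T$ is the full subcategory of direct sums of direct summands of $T$. Radical: $\Re(X,Y)$ is the set of morphisms $f:X\to Y$ such that $h'fh$ is not an isomorphism for all indecomposable $M$ and all $h:M\to X$, $h':Y\to M$. Powers $\Re^n$ are defined inductively, and $\Re^\infty=\bigcap_{i\ge1}\Re^i$. The depth $\mathrm{dp}(f)$ is $n$ if $f\in\Re^n\setminus\Re^{n+1}$, and $\infty$ if $f\in\Re^\infty$. An algebra is representation-finite if it has finitely many isomorphism classes of indecomposable modules; then the nilpotency index of $\Re(\mathrm{mod}\,A)$ is the minimal $m\ge1$ with $\Re^m(\mathrm{mod}\,A)=0$.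 A morphism $f$ is irreducible if it does not split and $f=gh$ implies $h$ is a split monomorphism or $g$ is a split epimorphism. For $f:X\to Y$ irreducible with $X$ or $Y$ indecomposable, the left degree $d_l(f)$ is the least natural number $m$ such that there are a module $Z$ and a morphism $g:Z\to X$ with $\mathrm{dp}(g)=m$ and $fg\in\Re^{m+2}(Z,Y)$, and $\infty$ if there is none; the right degree $d_r(f)$ is defined dually. The number $r_a$: put $n_a=0$ if $P_a=S_a$, otherwise $n_a=d_r(\iota_a)$ with $\iota_a:\mathrm{rad}\,P_a\hookrightarrow P_a$; put $m_a=0$ if $I_a=S_a$, otherwise $m_a=d_l(g_a)$ with $g_a:I_a\to I_a/\mathrm{soc}\,I_a$; and $r_a=n_a+m_a$. It is the length of any path of irreducible morphisms between indecomposable modules from $P_a$ to $I_a$ going through $S_a$. Tilting: $T$ is a tilting $A$-module if $\mathrm{pd}\,T\le1$, $\mathrm{Ext}^1_A(T,T)=0$ and the number of isomorphism classes of indecomposable summands of $T$ equals the number of vertices of $Q_A$. Put $\mathcal{T}(T)=\{X:\mathrm{Ext}^1_A(T,X)=0\}$ and $\mathcal{F}(T)=\{X:\mathrm{Hom}_A(T,X)=0\}$. $T$ is separating if every indecomposable $A$-module lies in $\mathcal{T}(T)$ or in $\mathcal{F}(T)$. *)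

(* Defs.v *)
From HB Require Import structures.
From mathcomp Require Import all_boot all_order all_algebra all_field.
From mathcomp Require Import boolp.

Set Implicit Arguments.
Unset Strict Implicit.
Unset Printing Implicit Defensive.

Import GRing.Theory.
Local Open Scope ring_scope.
Local Open Scope quotient_scope.

(* [option nat] stands for the extended natural numbers, [None] being infinity. *)

Definition least (P : nat -> Prop) : option nat :=
  match pselect (exists n, `[< P n >]) with
  | left exP => Some (ex_minn exP)
  | right _ => None
  end.

Definition addoo (m n : option nat) : option nat :=
  if (m, n) is (Some m', Some n') then Some (m' + n')%N else None.

Section SubmodulePredicate.
Context {R : pzRingType} {M : lmodType R} (N : submodClosed M).

(* [submodClosed] does not inherit from [zmodClosed], which the subtype and
   quotient constructions need; the copy [submod_pred N] of [N] has both. *)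
Definition submod_pred : {pred M} := fun x => x \in N.

Fact submod_pred_closed : submod_closed submod_pred.
Proof.
by split=> [|a x y xN yN]; [exact: (rpred0 N) | exact: (rpredD (rpredZ a xN) yN)].
Qed.
HB.instance Definition _ :=
  GRing.isSubmodClosed.Build R M submod_pred submod_pred_closed.

End SubmodulePredicate.

Section Submodule.
Context {R : pzRingType} {M : lmodType R} (N : submodClosed M).

Definition submod := {x : M | x \in submod_pred N}.
HB.instance Definition _ := [isSub of submod for sval].
HB.instance Definition _ := [Choice of submod by <:].
HB.instance Definition _ := [SubChoice_isSubZmodule of submod by <:].
HB.instance Definition _ := [SubZmodule_isSubLmodule of submod by <:].

Definition submod_incl : {linear submod -> M} := val.

End Submodule.

Section QuotientModule.
Context {R : pzRingType} {M : lmodType R} (N : submodClosed M).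

Definition quotmod := Quotient.quot (submod_pred N).
HB.instance Definition _ := GRing.Zmodule.on quotmod.

Definition quotmod_pi (x : M) : quotmod := \pi_(Quotient.quot (submod_pred N)) x.

Definition quotmod_scale (a : R) (x : quotmod) : quotmod :=
  quotmod_pi (a *: repr (x : Quotient.quot (submod_pred N))).

Lemma quotmod_piP (x y : M) :
  (quotmod_pi x == quotmod_pi y) = (x - y \in submod_pred N).
Proof. by rewrite Quotient.idealrBE. Qed.

Lemma quotmod_piD (x y : M) : quotmod_pi (x + y) = quotmod_pi x + quotmod_pi y.
Proof. exact: Quotient.pi_add. Qed.

Lemma quotmod_reprK (x : quotmod) :
  quotmod_pi (repr (x : Quotient.quot (submod_pred N))) = x.
Proof. exact: reprK. Qed.

Lemma quotmod_piZ a (x : M) :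
  quotmod_pi (a *: x) = quotmod_scale a (quotmod_pi x).
Proof.
apply/eqP; rewrite eq_sym quotmod_piP -scalerBr rpredZ //.
by rewrite -quotmod_piP quotmod_reprK.
Qed.

Fact quotmod_scaleA a b x :
  quotmod_scale a (quotmod_scale b x) = quotmod_scale (a * b) x.
Proof. by rewrite -[x]quotmod_reprK -!quotmod_piZ scalerA. Qed.

Fact quotmod_scale1 : left_id 1 quotmod_scale.
Proof. by move=> x; rewrite -[x]quotmod_reprK -quotmod_piZ scale1r. Qed.

Fact quotmod_scaleDr : right_distributive quotmod_scale +%R.
Proof.
move=> a x y; rewrite -[x]quotmod_reprK -[y]quotmod_reprK.
by rewrite -quotmod_piD -!quotmod_piZ scalerDr quotmod_piD.
Qed.

Fact quotmod_scaleDl x : {morph quotmod_scale^~ x : a b / a + b}.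
Proof.
by move=> a b; rewrite -[x]quotmod_reprK -!quotmod_piZ scalerDl quotmod_piD.
Qed.

HB.instance Definition _ := GRing.Zmodule_isLmodule.Build R quotmod
  quotmod_scaleA quotmod_scale1 quotmod_scaleDr quotmod_scaleDl.

Fact quotmod_pi_is_linear : linear quotmod_pi.
Proof. by move=> a x y; rewrite quotmod_piD quotmod_piZ. Qed.
HB.instance Definition _ :=
  GRing.isLinear.Build R M quotmod *:%R quotmod_pi quotmod_pi_is_linear.

Definition quotmod_proj : {linear M -> quotmod} := quotmod_pi.

End QuotientModule.

(* In [endring T], [f * g] is [f \o g]; its modules are left modules. *)

Section EndomorphismRing.
Context {R : pzRingType} (T : lmodType R).

Definition endring : Type := {linear T -> T}.
HB.instance Definition _ := gen_eqMixin endring.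
HB.instance Definition _ := gen_choiceMixin endring.

Implicit Types f g h : endring.

Lemma endringP f g : (forall x, f x = g x) -> f = g.
Proof.
case: f g => [f [[fA] [fZ]]] [g [[gA] [gZ]]] /= /funext efg.
case: _ / efg in gA gZ *.
by rewrite (Prop_irrelevance gA fA) (Prop_irrelevance gZ fZ).
Qed.

Definition end_zero : endring := \0 : {linear T -> T}.
Definition end_one : endring := idfun : {linear T -> T}.
Definition end_opp f : endring := \- (f : {linear T -> T}) : {linear T -> T}.
Definition end_add f g : endring :=
  (f : {linear T -> T}) \+ (g : {linear T -> T}) : {linear T -> T}.
Definition end_mul f g : endring :=
  (f : {linear T -> T}) \o (g : {linear T -> T}) : {linear T -> T}.

Fact end_addA : associative end_add.
Proof. by move=> f g h; apply: endringP => x; rewrite /= addrA. Qed.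
Fact end_addC : commutative end_add.
Proof. by move=> f g; apply: endringP => x; rewrite /= addrC. Qed.
Fact end_add0 : left_id end_zero end_add.
Proof. by move=> f; apply: endringP => x; rewrite /= add0r. Qed.
Fact end_addN : left_inverse end_zero end_opp end_add.
Proof. by move=> f; apply: endringP => x; rewrite /= addNr. Qed.
Fact end_mulA : associative end_mul.
Proof. by move=> f g h; apply: endringP. Qed.
Fact end_mul1 : left_id end_one end_mul.
Proof. by move=> f; apply: endringP. Qed.
Fact end_mulr1 : right_id end_one end_mul.
Proof. by move=> f; apply: endringP. Qed.
Fact end_mulDl : left_distributive end_mul end_add.
Proof. by move=> f g h; apply: endringP. Qed.
Fact end_mulDr : right_distributive end_mul end_add.
Proof. by move=> f g h; apply: endringP => x; rewrite /= linearD. Qed.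

HB.instance Definition _ := GRing.isPzRing.Build endring
  end_addA end_addC end_add0 end_addN end_mulA end_mul1 end_mulr1
  end_mulDl end_mulDr.

End EndomorphismRing.

Section ModuleCategory.
Context {R : pzRingType}.
Implicit Types M P T X Y Z : lmodType R.

Definition fin_gen M : Prop :=
  exists n (s : 'I_n -> M), forall x, exists c : 'I_n -> R,
    x = \sum_i c i *: s i.

Definition is_zero_mod M : Prop := forall x : M, x = 0.

Definition isomorphic X Y : Prop := exists f : {linear X -> Y}, bijective f.

Definition indecomposable M : Prop :=
  ~ is_zero_mod M /\
  forall X Y, isomorphic M (X * Y)%type -> is_zero_mod X \/ is_zero_mod Y.

Definition surjective_hom X Y (f : {linear X -> Y}) : Prop :=
  forall y, exists x, f x = y.

Definition is_summand X M : Prop := exists Y, isomorphic M (X * Y)%type.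

(* [add T]; the constructors build finite direct sums one summand at a time. *)
Inductive add_closure (T : lmodType R) : lmodType R -> Prop :=
  | AddZero Z : is_zero_mod Z -> add_closure T Z
  | AddSum X Y Z : is_summand X T -> add_closure T Y ->
      isomorphic Z (X * Y)%type -> add_closure T Z.

(* There are exactly [n] isomorphism classes of modules satisfying [P]. *)
Definition iso_class_count (P : lmodType R -> Prop) (n : nat) : Prop :=
  exists X : 'I_n -> lmodType R,
    [/\ forall i, P (X i),
        forall i j, isomorphic (X i) (X j) -> i = j &
        forall Y, P Y -> exists i, isomorphic Y (X i)].

Definition radical X Y (f : {linear X -> Y}) : Prop :=
  forall M, fin_gen M -> indecomposable M ->
  forall (h : {linear M -> X}) (h' : {linear Y -> M}),
    ~ bijective (fun x : M => h' (f (h x))).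

(* The powers of the radical as an ideal, the zeroth one being the whole
   category: a morphism in [R^(n+1)] is a finite sum of composites [g \o h],
   with [h] in [R] and [g] in [R^n]. *)
Fixpoint rad_pow (n : nat) X Y (f : {linear X -> Y}) {struct n} : Prop :=
  match n with
  | 0 => True
  | 1 => radical f
  | n'.+1 => exists m (Z : 'I_m -> lmodType R)
      (h : forall i, {linear X -> Z i}) (g : forall i, {linear Z i -> Y}),
      [/\ forall i, fin_gen (Z i),
          forall i, radical (h i),
          forall i, rad_pow n' (g i) &
          forall x, f x = \sum_i g i (h i x)]
  end.

Definition has_depth X Y (f : {linear X -> Y}) (n : nat) : Prop :=
  rad_pow n f /\ ~ rad_pow n.+1 f.

(* The degrees are only meant for irreducible morphisms with an indecomposable
   domain or codomain; the formula makes sense for every morphism. *)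
Definition left_degree X Y (f : {linear X -> Y}) : option nat :=
  least (fun m => exists (Z : lmodType R) (g : {linear Z -> X}),
    [/\ fin_gen Z, has_depth g m &
        rad_pow m.+2 (f \o g : {linear Z -> Y})]).

Definition right_degree X Y (f : {linear X -> Y}) : option nat :=
  least (fun m => exists (Z : lmodType R) (g : {linear Y -> Z}),
    [/\ fin_gen Z, has_depth g m &
        rad_pow m.+2 (g \o f : {linear X -> Z})]).

Definition maximal_submod M (N : submodClosed M) : Prop :=
  (exists x : M, x \notin N) /\
  forall N' : submodClosed M, {subset N <= N'} ->
    {subset N' <= N} \/ forall x : M, x \in N'.

Definition simple_submod M (N : submodClosed M) : Prop :=
  (exists2 x : M, x \in N & x != 0) /\
  forall N' : submodClosed M, {subset N' <= N} ->
    (forall x, x \in N' -> x = 0) \/ {subset N <= N'}.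

Definition radm M : {pred M} :=
  fun x => `[< forall N : submodClosed M, maximal_submod N -> x \in N >].

Definition socm M : {pred M} :=
  fun x => `[< exists n (s : 'I_n -> M),
    (forall i, exists2 N : submodClosed M, simple_submod N & s i \in N) /\
    x = \sum_i s i >].

Arguments radm : clear implicits.
Arguments socm : clear implicits.

Fact radm_closed M : submod_closed (radm M).
Proof.
split=> [|a x y /asboolP xr /asboolP yr]; apply/asboolP => N Nmax.
  exact: rpred0.
exact: rpredD (rpredZ _ (xr _ Nmax)) (yr _ Nmax).
Qed.
HB.instance Definition _ M :=
  GRing.isSubmodClosed.Build R M (radm M) (radm_closed M).

Fact socm_closed M : submod_closed (socm M).
Proof.
split=> [|a x y /asboolP[m [s [sS ->]]] /asboolP[n [t [tS ->]]]].
  by apply/asboolP; exists 0%N, (fun=> 0); split=> [[]//|]; rewrite big_ord0.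
apply/asboolP; exists (m + n)%N,
  (fun i => match split i with inl j => a *: s j | inr j => t j end).
split=> [i|].
  case: (split i) => j //; have [N NS sN] := sS j.
  by exists N => //; apply: rpredZ.
rewrite big_split_ord /= scaler_sumr; congr (_ + _); apply: eq_bigr => i _.
  by rewrite (unsplitK (inl i)).
by rewrite (unsplitK (inr i)).
Qed.
HB.instance Definition _ M :=
  GRing.isSubmodClosed.Build R M (socm M) (socm_closed M).

Definition projective P : Prop :=
  forall X Y (g : {linear X -> Y}) (f : {linear P -> Y}),
    fin_gen X -> fin_gen Y -> surjective_hom g ->
    exists f' : {linear P -> X}, forall x, g (f' x) = f x.

Definition short_exact X Y Z (i : {linear X -> Y}) (p : {linear Y -> Z}) :=
  [/\ injective i, surjective_hom p &
      forall y, p y = 0 <-> exists x, i x = y].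

Definition proj_dim_le1 T : Prop :=
  exists (P1 P0 : lmodType R) (i : {linear P1 -> P0}) (p : {linear P0 -> T}),
    [/\ fin_gen P1 /\ projective P1, fin_gen P0 /\ projective P0 &
        short_exact i p].

(* [Ext^1(X, Y) = 0] for the group of Yoneda extensions. *)
Definition ext1_zero X Y : Prop :=
  forall (E : lmodType R) (i : {linear Y -> E}) (p : {linear E -> X}),
    short_exact i p -> exists s : {linear X -> E}, forall x, p (s x) = x.

Definition hom_zero X Y : Prop :=
  forall (f : {linear X -> Y}) (x : X), f x = 0.

(* [n] is meant to be the number of vertices of the ordinary quiver. [T] need
   not be multiplicity-free. *)
Definition tilting (n : nat) T : Prop :=
  [/\ fin_gen T, proj_dim_le1 T, ext1_zero T T &
      iso_class_count (fun X => indecomposable X /\ is_summand X T) n].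

Definition separating T : Prop :=
  forall X, fin_gen X -> indecomposable X -> ext1_zero T X \/ hom_zero T X.

End ModuleCategory.
Arguments radm {R} M.
Arguments socm {R} M.

Definition rep_finite (R : pzRingType) : Prop :=
  exists n, iso_class_count (fun M : lmodType R => fin_gen M /\ indecomposable M) n.

Definition rad_pow_zero (R : pzRingType) (m : nat) : Prop :=
  forall (X Y : lmodType R) (f : {linear X -> Y}),
    fin_gen X -> fin_gen Y -> rad_pow m f -> forall x, f x = 0.

Definition nilpotency_index (R : pzRingType) (m : nat) : Prop :=
  [/\ (0 < m)%N, rad_pow_zero R m &
      forall m', (0 < m')%N -> rad_pow_zero R m' -> (m <= m')%N].

Record quiver := Quiver {
  vertex :> finType;
  arrow : finType;
  source : arrow -> vertex;
  target : arrow -> vertex }.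

(* The path with source [a] traversing successively the arrows of [s]. *)
Fixpoint is_path (Q : quiver) (a : Q) (s : seq (arrow Q)) : bool :=
  if s is x :: s' then (source x == a) && is_path (target x) s' else true.

Definition qpath (Q : quiver) :=
  {p : Q * seq (arrow Q) | is_path p.1 p.2}.

Definition path_length (Q : quiver) (p : qpath Q) : nat := size (val p).2.

Section BoundQuiver.
Context {k : fieldType} {A : falgType k} {Q : quiver}.

(* Paths compose like functions: the path traversing [x] first and then [y]
   is [y * x]. *)
Definition path_eval (e : Q -> A) (v : arrow Q -> A) (p : qpath Q) : A :=
  foldl (fun w x => v x * w) (e (val p).1) (val p).2.

End BoundQuiver.

(* An isomorphism [A ~ kQ/I] with [I] admissible, given as a surjective algebra
   morphism [kQ -> A] with kernel [I]. Such a morphism amounts to the images of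
   the trivial paths and of the arrows, subject to the first four conditions.
   An element of [kQ] is a linear combination of finitely many distinct paths;
   [bq_le] and [bq_ge] say that [I] is contained in the square of the arrow
   ideal and contains one of its powers. *)
Record bound_quiver (k : fieldType) (A : falgType k) (Q : quiver) := BoundQuiver {
  bq_e : Q -> A;
  bq_v : arrow Q -> A;
  bq_orth : forall a b, bq_e a * bq_e b = if a == b then bq_e a else 0;
  bq_sum1 : \sum_a bq_e a = 1;
  bq_source : forall x, bq_v x * bq_e (source x) = bq_v x;
  bq_target : forall x, bq_e (target x) * bq_v x = bq_v x;
  bq_surj : forall y : A, exists (s : seq (qpath Q)) (c : qpath Q -> k),
    y = \sum_(p <- s) c p *: path_eval bq_e bq_v p;
  bq_le : forall (s : seq (qpath Q)) (c : qpath Q -> k), uniq s ->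
    \sum_(p <- s) c p *: path_eval bq_e bq_v p = 0 ->
    forall p, p \in s -> (path_length p < 2)%N -> c p = 0;
  bq_ge : exists2 N : nat, (2 <= N)%N &
    forall p, (N <= path_length p)%N -> path_eval bq_e bq_v p = 0 }.

(* Below, [e] is meant to be the idempotent of a vertex [a]: then [projm e],
   [injm e] and [simplem e] are [P_a = A e_a], [I_a = D(e_a A)] and [S_a]. *)

Section VertexModules.
Context {k : fieldType} {A : falgType k} (e : A).

Definition left_ideal : {pred A^o} :=
  fun x => (x : A) \in ({:A} * <[e]>)%VS.

Fact left_ideal_closed : submod_closed left_ideal.
Proof.
split=> [|a x y]; first exact: mem0v.
rewrite !unfold_in => /memv_cosetP[u _ ->] /memv_cosetP[w _ ->].
by apply/memv_cosetP; exists (a * u + w); rewrite ?memvf // mulrDl -mulrA.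
Qed.
HB.instance Definition _ :=
  GRing.isSubmodClosed.Build A A^o left_ideal left_ideal_closed.

Definition projm : lmodType A := submod left_ideal.

Definition right_ideal : {vspace A} := (<[e]> * {:A})%VS.

Lemma right_idealM (u : subvs_of right_ideal) (x : A) :
  vsval u * x \in right_ideal.
Proof.
have := memv_mul (subvsP u) (memvf x); rewrite /right_ideal -prodvA.
by apply: subvP; apply: prodvSr; apply: subvf.
Qed.

(* The [k]-dual of the right module [e A], with [(x *: f) u = f (u * x)]. *)
Definition injm_type : Type := 'Hom(subvs_of right_ideal, k^o).
HB.instance Definition _ := GRing.Zmodule.on injm_type.

Definition right_mul (x : A) (u : subvs_of right_ideal) : subvs_of right_ideal :=
  Subvs (right_idealM u x).

Fact right_mul_is_linear x : linear (right_mul x).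
Proof.
by move=> a u w; apply: val_inj; rewrite /= mulrDl scalerAl.
Qed.
HB.instance Definition _ x := GRing.isLinear.Build k _ _ _ (right_mul x)
  (right_mul_is_linear x).

Definition injm_scale (x : A) (f : injm_type) : injm_type :=
  (f \o linfun (right_mul x))%VF.

Lemma injm_scaleE x f u : injm_scale x f u = f (right_mul x u).
Proof. by rewrite comp_lfunE lfunE. Qed.

Fact injm_scaleA x y f : injm_scale x (injm_scale y f) = injm_scale (x * y) f.
Proof.
apply/lfunP => u; rewrite !injm_scaleE; congr (f _).
by apply: val_inj; rewrite /= mulrA.
Qed.
Fact injm_scale1 : left_id 1 injm_scale.
Proof.
move=> f; apply/lfunP => u; rewrite injm_scaleE; congr (f _).
by apply: val_inj; rewrite /= mulr1.
Qed.
Fact injm_scaleDr : right_distributive injm_scale +%R.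
Proof.
by move=> x f g; apply/lfunP => u; rewrite !(injm_scaleE, add_lfunE).
Qed.
Fact injm_scaleDl f : {morph injm_scale^~ f : x y / x + y}.
Proof.
move=> x y; apply/lfunP => u; rewrite !(injm_scaleE, add_lfunE) -linearD.
by congr (f _); apply: val_inj; rewrite /= mulrDr.
Qed.
HB.instance Definition _ := GRing.Zmodule_isLmodule.Build A injm_type
  injm_scaleA injm_scale1 injm_scaleDr injm_scaleDl.

Definition injm : lmodType A := injm_type.

Definition simplem : lmodType A := quotmod (radm projm).

Definition rad_incl : {linear submod (radm projm) -> projm} :=
  submod_incl (radm projm).

Definition soc_proj : {linear injm -> quotmod (socm injm)} :=
  quotmod_proj (socm injm).

Definition n_vertex : option nat :=
  if `[< isomorphic projm simplem >] then Some 0%N else right_degree rad_incl.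

Definition m_vertex : option nat :=
  if `[< isomorphic injm simplem >] then Some 0%N else left_degree soc_proj.

Definition r_vertex : option nat := addoo n_vertex m_vertex.

End VertexModules.

(* Main.v *)
Require Import Defs.
From HB Require Import structures.
From mathcomp Require Import all_boot all_order all_algebra all_field.
From mathcomp Require Import boolp.

Set Implicit Arguments.
Unset Strict Implicit.
Unset Printing Implicit Defensive.

Import Order.TTheory GRing.Theory Num.Theory.
Local Open Scope ring_scope.

(** Let P = P_u and I = I_u.  The composite P -> S_u -> I of the top projection
    and the socle inclusion is nonzero, and it is deep in the radical: the first
    map is killed by the inclusion of rad P into P, so the minimality in the
    definition of the right degree n_u puts it in the n_u-th power of the
    radical; dually the second one lies in the m_u-th power.  Hence there is a
    nonzero morphism starting at P in the power r_u = r_A - 1 of the radical of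
    mod A ([deep_vertex_morphism]).  Writing it as a sum of composites and
    splitting the intermediate modules into indecomposables, we get a chain of
    r_A - 1 radical morphisms between indecomposables whose composite with some
    morphism out of P is nonzero.

    Since P is in add T, every indecomposable of the chain receives a nonzero
    morphism from T, so it is not in F(T), and it is in T(T) because T is
    separating.  On T(T) the functor Hom_A(T, -) is fully faithful, so it sends
    the chain to r_A - 1 radical morphisms over B with nonzero composite, and
    r_B > r_A - 1.  Left modules over the ring B of endomorphisms of T are
    reached by composing Hom_A(T, -) with the duality D = Hom_k(-, k); this makes
    the functor contravariant, which does not affect lengths of chains
    ([dual_hom_map_radical], [radical_chain]).

    Full faithfulness rests on the fact that every module in T(T) is generated
    by T ([tilting_generated]), that is, on Hom(T, W) = Ext^1(T, W) = 0 implying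
    W = 0 ([tilting_orthogonal_zero]).  This is where the number of
    indecomposable summands T_1, ..., T_n of T matters.  Write [M, X] for the
    dimension of Hom(M, X).  A resolution of T_i by two projectives shows that
    [T_i, X] is, for X in T(T), the value at the dimension vector of X of an
    integral linear form G_i.  If W <> 0, then its dimension vector is killed by
    G_1, ..., G_n, so these n forms in n variables are dependent and
    sum_i c_i [T_i, X] = 0 for all X in T(T), for some c <> 0.  Such a relation
    is impossible ([hom_dims_independent]).  Say c_i0 > 0; let u : U -> T_i0 be a
    right approximation by sums of the T_j with c_j < 0, and let K be its kernel.
    The trace of T in K is in T(T) and receives the same morphisms from the T_l
    as K.  So the relation, applied to this trace, to U and to T_i0, says that
    the codimensions of the images of Hom(T_l, U) -> Hom(T_l, T_i0), weighted by
    the c_l, add up to 0.  They vanish when c_l < 0, hence also when c_l > 0.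
    Thus the identity of T_i0 factors through U, and T_i0, whose endomorphism
    ring is local, is isomorphic to some T_j with c_j < 0: a contradiction. *)

(** * Linear maps, submodules and quotients *)

Section LinearMaps.
Context {R : pzRingType}.
Implicit Types X Y Z : lmodType R.

(** Linear maps are built from a function and a proof through this statement, so
    that no instance has to be declared for a function local to a proof. *)
Lemma linear_map_of X Y (f : X -> Y) : linear f ->
  exists g : {linear X -> Y}, forall x, g x = f x.
Proof.
move=> fL.
pose h := GRing.isLinear.Build R X Y *:%R f fL.
by exists (HB.pack_for {linear X -> Y} f h).
Qed.

Lemma linear_inverse X Y (f : {linear X -> Y}) : bijective f ->
  exists g : {linear Y -> X}, cancel f g /\ cancel g f.
Proof.
case=> g fK gK; have gL : linear g.
  by move=> a x y; apply: (can_inj fK); rewrite linearP !gK.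
by have [g' g'E] := linear_map_of gL; exists g'; split=> x; rewrite g'E.
Qed.

Lemma inj_linearP X Y (f : {linear X -> Y}) :
  injective f <-> forall x, f x = 0 -> x = 0.
Proof.
split=> [fI x fx0|f0 x y exy]; first by apply: fI; rewrite fx0 linear0.
by apply/eqP; rewrite -subr_eq0; apply/eqP/f0; rewrite linearB exy subrr.
Qed.

Lemma inj_surj_bij X Y (f : {linear X -> Y}) :
  injective f -> surjective_hom f -> bijective f.
Proof.
move=> fI /choice[g gK]; exists g => // x; exact/fI/gK.
Qed.

(** Quantified predicates become decidable ones by classical logic, as the type of
    submodules requires. *)
Lemma submod_of (M : lmodType R) (P : M -> Prop) :
  P 0 -> (forall a x y, P x -> P y -> P (a *: x + y)) ->
  exists N : submodClosed M, forall x, x \in N <-> P x.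
Proof.
move=> P0 PL; pose N : {pred M} := fun x => `[< P x >].
have NE x : x \in N <-> P x by split=> /asboolP.
have NC : submod_closed N.
  by split=> [|a x y /NE Px /NE Py]; apply/NE => //; apply: PL.
pose h := GRing.isSubmodClosed.Build R M N NC.
by exists (HB.pack_for (submodClosed M) N h).
Qed.

Lemma submod_inclP (M : lmodType R) (N : submodClosed M) (x : submod N) :
  submod_incl N x \in N.
Proof. exact: valP x. Qed.

Lemma submod_incl_inj (M : lmodType R) (N : submodClosed M) : injective (submod_incl N).
Proof. exact: val_inj. Qed.

Lemma submod_incl_surj (M : lmodType R) (N : submodClosed M) x :
  x \in N -> exists y, submod_incl N y = x.
Proof. by move=> xN; exists (exist _ x xN). Qed.

Lemma corestrict (M X : lmodType R) (N : submodClosed M) (f : {linear X -> M}) :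
  (forall x, f x \in N) ->
  exists g : {linear X -> submod N}, forall x, submod_incl N (g x) = f x.
Proof.
move=> fN; have gL : linear (fun x => exist _ (f x) (fN x) : submod N).
  by move=> a x y; apply: val_inj; rewrite /= linearP.
by have [g gE] := linear_map_of gL; exists g => x; rewrite gE.
Qed.

Lemma inj_corestrict X Y Z (i : {linear X -> Y}) (f : {linear Z -> Y}) :
  injective i -> (forall z, exists x, i x = f z) ->
  exists g : {linear Z -> X}, forall z, i (g z) = f z.
Proof.
move=> iI /choice[g gE]; have gL : linear g.
  by move=> a x y; apply: iI; rewrite linearP !gE linearP.
by have [g' g'E] := linear_map_of gL; exists g' => z; rewrite g'E.
Qed.

Lemma surj_factor X Y Z (p : {linear X -> Y}) (f : {linear X -> Z}) :
  surjective_hom p -> (forall x, p x = 0 -> f x = 0) ->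
  exists g : {linear Y -> Z}, forall x, g (p x) = f x.
Proof.
move=> /choice[s sK] f0; have gE x : f (s (p x)) = f x.
  by apply/eqP; rewrite -subr_eq0 -linearB; apply/eqP/f0; rewrite linearB sK subrr.
have gL : linear (fun y => f (s y)).
  by move=> a x y; rewrite -{1}[x]sK -{1}[y]sK -linearP gE linearP.
by have [g gE'] := linear_map_of gL; exists g => x; rewrite gE'.
Qed.

Lemma quotmod_proj_surj (M : lmodType R) (N : submodClosed M) : surjective_hom (quotmod_proj N).
Proof. by move=> y; have yE := quotmod_reprK y; eexists; exact: yE. Qed.

Lemma quotmod_proj0 (M : lmodType R) (N : submodClosed M) x :
  quotmod_proj N x = 0 <-> x \in N.
Proof.
have := quotmod_piP N x 0; rewrite subr0 => e; split=> [/eqP|xN].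
  by rewrite -[0](linear0 (quotmod_proj N)) e.
by apply/eqP; rewrite -[0](linear0 (quotmod_proj N)) e.
Qed.

Definition subf X Y (f g : {linear X -> Y}) : {linear X -> Y} := f \- g.

(** Kernels, images and cokernels are given by their defining maps, which is all
    that the exactness arguments use. *)
Lemma linear_kernel X Y (f : {linear X -> Y}) :
  exists (K : lmodType R) (i : {linear K -> X}),
    injective i /\ forall x, f x = 0 <-> exists z, i z = x.
Proof.
have [N NE] : exists N : submodClosed X, forall x, x \in N <-> f x = 0.
  apply: submod_of; first exact: linear0.
  by move=> a x y x0 y0; rewrite linearP x0 y0 scaler0 addr0.
exists (submod N), (submod_incl N); split=> [|x]; first exact: submod_incl_inj.
rewrite -NE; split=> [|[z <-]]; first exact: submod_incl_surj.
exact: submod_inclP.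
Qed.

Lemma linear_image X Y (f : {linear X -> Y}) :
  exists Z (h : {linear X -> Z}) (j : {linear Z -> Y}),
    [/\ surjective_hom h, injective j & forall x, j (h x) = f x].
Proof.
have [N NE] : exists N : submodClosed Y, forall y, y \in N <-> exists x, f x = y.
  apply: submod_of; first by exists 0; rewrite linear0.
  by move=> a _ _ [x <-] [y <-]; exists (a *: x + y); rewrite linearP.
have [h hE] : exists h : {linear X -> submod N}, forall x, submod_incl N (h x) = f x.
  by apply: corestrict => x; apply/NE; exists x.
have jI := @submod_incl_inj _ N.
exists (submod N), h, (submod_incl N); split=> // y.
by have /NE[x xE] := submod_inclP y; exists x; apply: jI; rewrite hE.
Qed.

Lemma linear_cokernel X Y (f : {linear X -> Y}) :
  exists Z (p : {linear Y -> Z}),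
    surjective_hom p /\ forall y, p y = 0 <-> exists x, f x = y.
Proof.
have [N NE] : exists N : submodClosed Y, forall y, y \in N <-> exists x, f x = y.
  apply: submod_of; first by exists 0; rewrite linear0.
  by move=> a _ _ [x <-] [y <-]; exists (a *: x + y); rewrite linearP.
exists (quotmod N), (quotmod_proj N); split=> [|y]; first exact: quotmod_proj_surj.
by rewrite quotmod_proj0 NE.
Qed.

Lemma linear_inl X Y : exists i : {linear X -> (X * Y)%type}, forall x, i x = (x, 0).
Proof.
by apply: linear_map_of => a x y; congr pair; rewrite /= scaler0 addr0.
Qed.

Lemma linear_inr X Y : exists i : {linear Y -> (X * Y)%type}, forall y, i y = (0, y).
Proof.
by apply: linear_map_of => a x y; congr pair; rewrite /= scaler0 addr0.
Qed.

Lemma summandP X Y : is_summand X Y ->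
  exists (s : {linear X -> Y}) (r : {linear Y -> X}), forall x, r (s x) = x.
Proof.
move=> [Z [f /linear_inverse[g [fK gK]]]]; have [i iE] := linear_inl X Z.
by exists (g \o i), (fst \o f) => x /=; rewrite gK iE.
Qed.

Lemma rV_lift X n (s : 'I_n -> X) :
  exists f : {linear 'rV[R]_n -> X}, forall u, f u = \sum_i u 0 i *: s i.
Proof.
pose f (u : 'rV[R]_n) := \sum_i u 0 i *: s i.
have fL : linear f.
  move=> a x y; rewrite /f scaler_sumr -big_split; apply: eq_bigr => i _.
  by rewrite !mxE scalerDl scalerA.
by have [g gE] := linear_map_of fL; exists g => u; rewrite gE.
Qed.

Lemma fin_gen_fintype X (J : finType) (s : J -> X) :
  (forall x, exists c : J -> R, x = \sum_j c j *: s j) -> fin_gen X.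
Proof.
move=> sP; exists #|J|, (fun i => s (enum_val i)) => x; have [c ->] := sP x.
by exists (fun i => c (enum_val i)); rewrite -(big_enum_val (fun j => c j *: s j)).
Qed.

Lemma fin_gen_surj X Y (f : {linear X -> Y}) : fin_gen X -> surjective_hom f -> fin_gen Y.
Proof.
move=> [n [s sP]] fS; exists n, (fun i => f (s i)) => y.
have [x <-] := fS y; have [c ->] := sP x; exists c.
by rewrite linear_sum; apply: eq_bigr => i _; rewrite linearZ.
Qed.

Lemma fin_gen_extension X Y Z (i : {linear X -> Y}) (p : {linear Y -> Z}) :
  fin_gen X -> fin_gen Z -> short_exact i p -> fin_gen Y.
Proof.
move=> [m [s sP]] [n [t tP]] [_ pS ip]; have [t' t'P] := choice pS.
exists (m + n)%N, (fun j => match split j with inl a => i (s a) | inr b => t' (t b) end).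
move=> y; have [d dE] := tP (p y).
have [x xE] : exists x, i x = y - \sum_j d j *: t' (t j).
  apply/ip; rewrite linearB linear_sum dE; apply/eqP; rewrite subr_eq0; apply/eqP.
  by apply: eq_bigr => j _; rewrite linearZ /= t'P.
have [c cE] := sP x.
exists (fun j => match split j with inl a => c a | inr b => d b end).
rewrite big_split_ord /= -[LHS](subrK (\sum_j d j *: t' (t j))) -xE cE linear_sum.
congr (_ + _); apply: eq_bigr => j _.
  by rewrite linearZ (unsplitK (inl j)).
by rewrite (unsplitK (inr j)).
Qed.

End LinearMaps.

(** * Dimension over a field *)
Section Dimension.
Context {k : fieldType}.
Implicit Types U V W : lmodType k.

(** Abstract vector spaces carry no chosen basis, so finite dimension is a
    property, and [kdim] below is a number extracted from it classically. *)
Definition has_dim V n := exists f : {linear 'rV[k]_n -> V}, bijective f.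

Lemma rV_inj_leq m n (f : {linear 'rV[k]_m -> 'rV[k]_n}) : injective f -> (m <= n)%N.
Proof.
move=> fI; have : row_free (lin1_mx f).
  rewrite -kermx_eq0; apply/rowV0P => v /sub_kermxP; rewrite mul_rV_lin1.
  by move/(inj_linearP f): fI; apply.
by rewrite /row_free => /eqP<-; apply: rank_leq_col.
Qed.

Lemma rV_lift_surj V W n (p : {linear V -> W}) (f : {linear 'rV[k]_n -> W}) :
  surjective_hom p -> exists g : {linear 'rV[k]_n -> V}, forall u, p (g u) = f u.
Proof.
move=> /choice[s sK]; have [g gE] := rV_lift (fun i => s (f (delta_mx 0 i))).
exists g => u; rewrite gE linear_sum [in RHS](row_sum_delta u) linear_sum.
by apply: eq_bigr => i _; rewrite !linearZ /= sK.
Qed.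

(** A linearly independent family of maximal size is a basis; a bound on these
    sizes is thus enough for finite dimension, whether it comes from a spanning
    family or from an ambient space. *)
Lemma bounded_dim V b :
  (forall m (f : {linear 'rV[k]_m -> V}), injective f -> (m <= b)%N) ->
  exists2 n, has_dim V n & (n <= b)%N.
Proof.
move=> Vb; pose P m := `[< exists f : {linear 'rV[k]_m -> V}, injective f >].
have exP : exists m, P m.
  exists 0%N; apply/asboolP; have [f _] := rV_lift (fun _ : 'I_0 => 0 : V).
  by exists f => x y _; rewrite [x]thinmx0 [y]thinmx0.
have Pb m : P m -> (m <= b)%N by move=> /asboolP[f fI]; apply: Vb fI.
case: (ex_maxnP exP Pb) => n /asboolP[f fI] nmax.
exists n; last exact: Vb fI.
exists f; apply: (inj_surj_bij fI) => v; apply: contrapT => nv.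
have /nmax : P (n + 1)%N; last by rewrite addn1 ltnn.
apply/asboolP.
pose g (u : 'rV[k]_(n + 1)) := f (lsubmx u) + rsubmx u 0 0 *: v.
have gL : linear g.
  by move=> a x y; rewrite /g !linearP !mxE scalerDl scalerDr -scalerA addrACA.
(* A vector [v] outside the image extends the family by one element. *)
have [h hE] := linear_map_of gL; exists h.
apply/inj_linearP => u; rewrite hE /g => u0.
have r0 : rsubmx u 0 0 = 0.
  apply: contra_notP nv => /eqP r0; exists (- (rsubmx u 0 0)^-1 *: lsubmx u).
  move/eqP: u0; rewrite addr_eq0 => /eqP u0.
  by rewrite linearZ /= u0 scaleNr scalerN opprK scalerA mulVf ?scale1r.
move: u0; rewrite r0 scale0r addr0 -(linear0 f) => /fI l0.
by rewrite -[u]hsubmxK l0 [rsubmx u]mx11_scalar r0 raddf0 row_mx0.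
Qed.

Lemma fin_gen_has_dim V : fin_gen V -> exists n, has_dim V n.
Proof.
case=> b [s sP]; have [p pE] := rV_lift s.
have pS : surjective_hom p.
  move=> x; have [c ->] := sP x; exists (\row_i c i); rewrite pE.
  by apply: eq_bigr => i _; rewrite mxE.
case: (@bounded_dim V b) => [m f fI|n Vn _]; last by exists n.
have [g gE] := rV_lift_surj f pS; apply: (@rV_inj_leq _ _ g).
by move=> x y exy; apply: fI; rewrite -!gE exy.
Qed.

Lemma has_dim_inj V W (f : {linear V -> W}) m n :
  has_dim V m -> has_dim W n -> injective f -> (m <= n)%N.
Proof.
move=> [g gB] [h hB] fI; have [h' [hK h'K]] := linear_inverse hB.
apply: (@rV_inj_leq _ _ (h' \o (f \o g))) => x y /= /(can_inj h'K)/fI.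
exact: bij_inj.
Qed.

Lemma has_dim_unique V m n : has_dim V m -> has_dim V n -> m = n.
Proof.
by move=> Vm Vn; apply/eqP; rewrite eqn_leq !(@has_dim_inj V V idfun).
Qed.

Lemma has_dim_fin_gen V n : has_dim V n -> fin_gen V.
Proof.
move=> [f /linear_inverse[g [_ gK]]]; exists n, (fun i => f (delta_mx 0 i)) => x.
exists (g x 0); rewrite -{1}[x]gK [in LHS](row_sum_delta (g x)) linear_sum.
by apply: eq_bigr => i _; rewrite linearZ.
Qed.

Lemma has_dim_subspace V W (f : {linear V -> W}) n :
  has_dim W n -> injective f -> exists2 m, has_dim V m & (m <= n)%N.
Proof.
move=> [h hB] fI; have [h' [hK h'K]] := linear_inverse hB.
apply: bounded_dim => m g gI; apply: (@rV_inj_leq _ _ (h' \o (f \o g))).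
by move=> x y /= /(can_inj h'K)/fI/gI.
Qed.

Definition kdim V : nat :=
  if pselect (exists n, has_dim V n) is left exn then projT1 (cid exn) else 0%N.

Lemma kdimP V : fin_gen V -> has_dim V (kdim V).
Proof.
by move=> /fin_gen_has_dim exn; rewrite /kdim; case: pselect => // ex; case: cid.
Qed.

Lemma kdim_eq V n : has_dim V n -> kdim V = n.
Proof.
by move=> Vn; apply: (has_dim_unique _ Vn); apply/kdimP/(has_dim_fin_gen Vn).
Qed.

Lemma fin_gen_inj V W (f : {linear V -> W}) : fin_gen W -> injective f -> fin_gen V.
Proof.
by move=> /kdimP Wn /(has_dim_subspace Wn)[m /has_dim_fin_gen].
Qed.

Lemma kdim_inj V W (f : {linear V -> W}) :
  fin_gen W -> injective f -> (kdim V <= kdim W)%N.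
Proof.
move=> Wf fI; apply: (has_dim_inj _ _ fI); apply: kdimP => //.
exact: fin_gen_inj Wf fI.
Qed.

Lemma short_exact_kdim U V W (f : {linear U -> V}) (g : {linear V -> W}) :
  fin_gen U -> fin_gen W -> short_exact f g -> kdim V = (kdim U + kdim W)%N.
Proof.
move=> /kdimP[u uB] /kdimP[w wB] [fI gS fg]; apply: kdim_eq.
have [l lE] := rV_lift_surj w gS.
pose h (x : 'rV[k]_(kdim U + kdim W)) := f (u (lsubmx x)) + l (rsubmx x).
have hL : linear h by move=> a x y; rewrite /h !linearP /= scalerDr addrACA.
have [h' hE] := linear_map_of hL; exists h'; apply: inj_surj_bij.
  apply/inj_linearP => x; rewrite hE /h => x0.
  have gf z : g (f z) = 0 by apply/fg; exists z.
  have r0 : rsubmx x = 0.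
    apply: (bij_inj wB); rewrite linear0 -lE.
    by move/(congr1 g): x0; rewrite linearD gf add0r linear0.
  move: x0; rewrite r0 linear0 addr0 -(linear0 f) => /fI.
  rewrite -(linear0 u) => /(bij_inj uB) l0.
  by rewrite -[x]hsubmxK l0 r0 row_mx0.
move=> v; have [w' _ wK] := wB; have [u' _ uK] := uB.
have [z zE] : exists z, f z = v - l (w' (g v)).
  by apply/fg; rewrite linearB lE wK subrr.
exists (row_mx (u' z) (w' (g v))); rewrite hE /h row_mxKl row_mxKr uK zE.
by rewrite subrK.
Qed.

Lemma kdim0P V : fin_gen V -> kdim V = 0%N -> forall x : V, x = 0.
Proof.
move=> /kdimP[f [g _ gK]] V0 x; rewrite -[x]gK; move: f g gK; rewrite V0 => f g _.
by rewrite [g x]thinmx0 linear0.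
Qed.

Lemma kdim_inj_surj V W (f : {linear V -> W}) :
  fin_gen W -> injective f -> (kdim W <= kdim V)%N -> surjective_hom f.
Proof.
move=> Wf fI WV; have [Z [p [pS fp]]] := linear_cokernel f.
have Zf := fin_gen_surj Wf pS.
have E : kdim W = (kdim V + kdim Z)%N.
  by apply: (short_exact_kdim (fin_gen_inj Wf fI) Zf (f := f) (g := p)); split.
have /(kdim0P Zf) Z0 : kdim Z = 0%N.
  by apply/eqP; rewrite -leqn0 -(leq_add2l (kdim V)) addn0 -E.
by move=> y; apply/fp/Z0.
Qed.

Lemma kdim_zero V : (forall x : V, x = 0) -> kdim V = 0%N.
Proof.
move=> V0; apply: kdim_eq; have [f _] := rV_lift (fun _ : 'I_0 => 0 : V).
exists f; apply: inj_surj_bij => [x y _|y]; first by rewrite [x]thinmx0 [y]thinmx0.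
by exists 0; rewrite (V0 y) linear0.
Qed.

Lemma kdim_bij V W (f : {linear V -> W}) : fin_gen W -> bijective f -> kdim V = kdim W.
Proof.
move=> Wf fB; have [g [fK gK]] := linear_inverse fB.
have Vf := fin_gen_inj Wf (can_inj fK).
by apply/eqP; rewrite eqn_leq (kdim_inj Wf (can_inj fK)) (kdim_inj Vf (can_inj gK)).
Qed.

(** The defect in the inequality is the codimension of the image of [g], so it
    vanishes exactly when [g] is surjective. *)
Lemma left_exact_kdim U V W (f : {linear U -> V}) (g : {linear V -> W}) :
  fin_gen V -> fin_gen W -> injective f ->
  (forall y, g y = 0 <-> exists x, f x = y) ->
  (kdim V <= kdim U + kdim W)%N /\
  (kdim V = (kdim U + kdim W)%N <-> surjective_hom g).
Proof.
move=> Vf Wf fI fg.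
have [N [h [j [hS jI hE]]]] := linear_image g.
have Nf := fin_gen_inj Wf jI.
have /(short_exact_kdim (fin_gen_inj Vf fI) Nf) -> : short_exact f h.
  split=> // y; rewrite -fg -hE.
  by split=> [->|e]; [rewrite linear0|apply: jI; rewrite e linear0].
have NW := kdim_inj Wf jI; split; first by rewrite leq_add2l.
split=> [/eqP|gS]; last first.
  congr addn; apply: kdim_bij Wf _; apply: inj_surj_bij jI _ => y.
  by have [x <-] := gS y; exists (h x).
rewrite eqn_add2l => /eqP e y.
have [z <-] := kdim_inj_surj Wf jI (eq_leq (esym e)) y.
by have [x <-] := hS z; exists x.
Qed.
End Dimension.

(** * Finite products of modules *)
Section ProductModule.
Context {R : pzRingType} {I : finType} (M : I -> lmodType R).

Definition prodm : Type := forall i, M i.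
Implicit Types x y z : prodm.
HB.instance Definition _ := gen_eqMixin prodm.
HB.instance Definition _ := gen_choiceMixin prodm.

Definition prodm_zero : prodm := fun i => 0.
Definition prodm_opp x : prodm := fun i => - x i.
Definition prodm_add x y : prodm := fun i => x i + y i.
Definition prodm_scale a x : prodm := fun i => a *: x i.

Fact prodm_addA : associative prodm_add.
Proof. by move=> x y z; apply: functional_extensionality_dep => i; apply: addrA. Qed.
Fact prodm_addC : commutative prodm_add.
Proof. by move=> x y; apply: functional_extensionality_dep => i; apply: addrC. Qed.
Fact prodm_add0 : left_id prodm_zero prodm_add.
Proof. by move=> x; apply: functional_extensionality_dep => i; apply: add0r. Qed.
Fact prodm_addN : left_inverse prodm_zero prodm_opp prodm_add.
Proof. by move=> x; apply: functional_extensionality_dep => i; apply: addNr. Qed.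
HB.instance Definition _ := GRing.isZmodule.Build prodm
  prodm_addA prodm_addC prodm_add0 prodm_addN.

Fact prodm_scaleA a b x : prodm_scale a (prodm_scale b x) = prodm_scale (a * b) x.
Proof. by apply: functional_extensionality_dep => i; apply: scalerA. Qed.
Fact prodm_scale1 : left_id 1 prodm_scale.
Proof. by move=> x; apply: functional_extensionality_dep => i; apply: scale1r. Qed.
Fact prodm_scaleDr : right_distributive prodm_scale +%R.
Proof. by move=> a x y; apply: functional_extensionality_dep => i; apply: scalerDr. Qed.
Fact prodm_scaleDl x : {morph prodm_scale^~ x : a b / a + b}.
Proof. by move=> a b; apply: functional_extensionality_dep => i; apply: scalerDl. Qed.
HB.instance Definition _ := GRing.Zmodule_isLmodule.Build R prodm
  prodm_scaleA prodm_scale1 prodm_scaleDr prodm_scaleDl.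

Definition prodm_eval i (x : prodm) : M i := x i.
Fact prodm_eval_is_linear i : linear (prodm_eval i).
Proof. by []. Qed.
HB.instance Definition _ i :=
  GRing.isLinear.Build R prodm (M i) *:%R (prodm_eval i) (prodm_eval_is_linear i).
Definition prodm_proj i : {linear prodm -> M i} := prodm_eval i.

Definition prodm_put i (x : M i) : prodm := dfwith (prodm_zero : forall i, M i) x.
Fact prodm_put_is_linear i : linear (@prodm_put i).
Proof.
move=> a x y; apply: functional_extensionality_dep => j.
have -> : (a *: prodm_put x + prodm_put y : prodm) j = a *: prodm_put x j + prodm_put y j by [].
rewrite /prodm_put; have [<-|ij] := eqVneq i j; first by rewrite !dfwith_in.
by rewrite !dfwith_out // scaler0 addr0.
Qed.
HB.instance Definition _ i :=
  GRing.isLinear.Build R (M i) prodm *:%R (@prodm_put i) (@prodm_put_is_linear i).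
Definition prodm_inj i : {linear M i -> prodm} := @prodm_put i.

Lemma prodm_injK i (x : M i) : prodm_proj i (prodm_inj i x) = x.
Proof. exact: dfwith_in. Qed.

Lemma prodm_inj_out i j (x : M i) : i != j -> prodm_proj j (prodm_inj i x) = 0.
Proof. exact: dfwith_out. Qed.

Lemma prodm_sum x : x = \sum_i prodm_inj i (prodm_proj i x).
Proof.
apply: functional_extensionality_dep => j; rewrite -[RHS]/(prodm_proj j _) linear_sum.
rewrite (bigD1 j) //= prodm_injK big1 ?addr0 // => i ij.
by rewrite prodm_inj_out.
Qed.

Lemma prodm_copair (Y : lmodType R) (f : forall i, {linear M i -> Y}) :
  exists2 g : {linear prodm -> Y}, forall x, g x = \sum_i f i (prodm_proj i x) &
    forall i (x : M i), g (prodm_inj i x) = f i x.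
Proof.
have gL : linear (fun x : prodm => \sum_i f i (prodm_proj i x)).
  move=> a x y; rewrite scaler_sumr -big_split; apply: eq_bigr => i _.
  by rewrite !linearP.
have [g gE] := linear_map_of gL; exists g => // j x.
rewrite gE (bigD1 j) //= prodm_injK big1 ?addr0 // => i ij.
by rewrite prodm_inj_out 1?eq_sym // linear0.
Qed.

Lemma prodm_fin_gen : (forall i, fin_gen (M i)) -> fin_gen prodm.
Proof.
move=> /choice[n nP]; pose s i := projT1 (cid (nP i)).
have sP i (x : M i) : exists c, x = \sum_j c j *: s i j by exact: (projT2 (cid (nP i))).
pose c i (x : M i) := projT1 (cid (sP i x)).
have cP i (x : M i) : x = \sum_j c i x j *: s i j by exact: (projT2 (cid (sP i x))).
apply: (@fin_gen_fintype _ _ {i : I & 'I_(n i)}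
  (fun p => prodm_inj (tag p) (s (tag p) (tagged p)))) => x.
exists (fun p => c (tag p) (prodm_proj (tag p) x) (tagged p)).
transitivity (\sum_i \sum_(j < n i) c i (prodm_proj i x) j *: prodm_inj i (s i j)).
  rewrite [LHS]prodm_sum; apply: eq_bigr => i _.
  rewrite {1}[prodm_proj i x](cP i) linear_sum.
  by apply: eq_bigr => j _; rewrite linearZ.
by rewrite (sig_big_dep (J := fun i => 'I_(n i)) predT (fun=> predT)
  (fun i j => c i (prodm_proj i x) j *: prodm_inj i (s i j))).
Qed.

End ProductModule.

(** * Modules over an algebra as vector spaces *)
Section Restriction.
Context {k : fieldType} {A : falgType k}.
Implicit Types M N X Y Z : lmodType A.

(** A separate type keeps the actions of the field and of the algebra apart. *)
Definition resk M : Type := M.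
HB.instance Definition _ M := GRing.Zmodule.on (resk M).
Definition resk_scale M (c : k) (x : resk M) : resk M := (c%:A : A) *: (x : M).

Lemma scalar_algM (c : k) (a : A) : c%:A * a = a * c%:A.
Proof. by rewrite mulr_algl mulr_algr. Qed.

Fact resk_scaleA M c d (x : resk M) : resk_scale c (resk_scale d x) = resk_scale (c * d) x.
Proof. by rewrite /resk_scale scalerA mulr_algl scalerA. Qed.
Fact resk_scale1 M : left_id 1 (@resk_scale M).
Proof. by move=> x; rewrite /resk_scale !scale1r. Qed.
Fact resk_scaleDr M : right_distributive (@resk_scale M) +%R.
Proof. by move=> c x y; rewrite /resk_scale scalerDr. Qed.
Fact resk_scaleDl M x : {morph (@resk_scale M)^~ x : c d / c + d}.
Proof. by move=> c d; rewrite /resk_scale scalerDl scalerDl. Qed.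
HB.instance Definition _ M := GRing.Zmodule_isLmodule.Build k (resk M)
  (@resk_scaleA M) (@resk_scale1 M) (@resk_scaleDr M) (@resk_scaleDl M).

Lemma resk_scaleE M c (x : resk M) : c *: x = (c%:A : A) *: (x : M).
Proof. by []. Qed.

Lemma resk_map X Y (f : {linear X -> Y}) :
  exists g : {linear resk X -> resk Y}, forall x : X, g x = f x.
Proof.
by apply: linear_map_of => c x y; rewrite !resk_scaleE linearP.
Qed.

(** The products of a basis of the algebra with generators of the module span it
    over the field. *)
Lemma fin_gen_resk M : fin_gen M <-> fin_gen (resk M).
Proof.
split=> [[n [s sP]]|[n [s sP]]]; last first.
  by exists n, s => x; have [c cE] := sP x; exists (fun i => (c i)%:A).
pose b := vbasis {:A}; pose d := \dim {:A}.
apply: (@fin_gen_fintype _ _ ('I_n * 'I_d)%type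
  (fun ij => b`_(ij.2) *: s ij.1 : resk M)) => x.
have [c cE] := sP x; exists (fun ij => coord b ij.2 (c ij.1)); rewrite [LHS]cE.
transitivity (\sum_i \sum_j coord b j (c i) *: (b`_j *: s i : resk M)).
  apply: eq_bigr => i _; rewrite {1}(coord_vbasis (memvf (c i))) scaler_suml.
  by apply: eq_bigr => j _; rewrite resk_scaleE scalerA mulr_algl.
by rewrite pair_bigA.
Qed.

Lemma fin_gen_submod M X (f : {linear X -> M}) : fin_gen M -> injective f -> fin_gen X.
Proof.
move=> /fin_gen_resk Mf fI; apply/fin_gen_resk; have [g gE] := resk_map f.
by apply: (fin_gen_inj (f := g) Mf) => x y; rewrite !gE; apply: fI.
Qed.

Definition homs M X : Type := {linear M -> X}.
HB.instance Definition _ M X := gen_eqMixin (homs M X).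
HB.instance Definition _ M X := gen_choiceMixin (homs M X).

Lemma homsP M X (f g : homs M X) : (forall x, f x = g x) -> f = g.
Proof.
case: f g => [f [[fA] [fZ]]] [g [[gA] [gZ]]] /= /funext efg.
case: _ / efg in gA gZ *.
by rewrite (Prop_irrelevance gA fA) (Prop_irrelevance gZ fZ).
Qed.

Section HomSpace.
Context (M X : lmodType A).
Implicit Types f g h : homs M X.

Definition homs_zero : homs M X := \0 : {linear M -> X}.
Definition homs_opp f : homs M X := \- (f : {linear M -> X}) : {linear M -> X}.
Definition homs_add f g : homs M X :=
  (f : {linear M -> X}) \+ (g : {linear M -> X}) : {linear M -> X}.

Definition homs_scale_fun (c : k) f (x : M) : X := (c%:A : A) *: (f x : X).
Fact homs_scale_is_linear c f : linear (homs_scale_fun c f).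
Proof.
by move=> a x y; rewrite /homs_scale_fun linearP scalerDr !scalerA scalar_algM.
Qed.
HB.instance Definition _ c f :=
  GRing.isLinear.Build A M X *:%R (homs_scale_fun c f) (homs_scale_is_linear c f).
Definition homs_scale c f : homs M X := homs_scale_fun c f : {linear M -> X}.

Fact homs_addA : associative homs_add.
Proof. by move=> f g h; apply: homsP => x; rewrite /= addrA. Qed.
Fact homs_addC : commutative homs_add.
Proof. by move=> f g; apply: homsP => x; rewrite /= addrC. Qed.
Fact homs_add0 : left_id homs_zero homs_add.
Proof. by move=> f; apply: homsP => x; rewrite /= add0r. Qed.
Fact homs_addN : left_inverse homs_zero homs_opp homs_add.
Proof. by move=> f; apply: homsP => x; rewrite /= addNr. Qed.
HB.instance Definition _ := GRing.isZmodule.Build (homs M X)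
  homs_addA homs_addC homs_add0 homs_addN.
Fact homs_scaleA c d f : homs_scale c (homs_scale d f) = homs_scale (c * d) f.
Proof. by apply: homsP => x; rewrite /= /homs_scale_fun /= scalerA mulr_algl scalerA. Qed.
Fact homs_scale1 : left_id 1 homs_scale.
Proof. by move=> f; apply: homsP => x; rewrite /= /homs_scale_fun !scale1r. Qed.
Fact homs_scaleDr : right_distributive homs_scale +%R.
Proof. by move=> c f g; apply: homsP => x; rewrite /= /homs_scale_fun scalerDr. Qed.
Fact homs_scaleDl f : {morph homs_scale^~ f : c d / c + d}.
Proof. by move=> c d; apply: homsP => x; rewrite /= /homs_scale_fun !scalerDl. Qed.
HB.instance Definition _ := GRing.Zmodule_isLmodule.Build k (homs M X)
  homs_scaleA homs_scale1 homs_scaleDr homs_scaleDl.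

Lemma homs_addE f g x : (f + g : homs M X) x = f x + g x. Proof. by []. Qed.
Lemma homs_0E x : (0 : homs M X) x = 0. Proof. by []. Qed.
Lemma homs_scaleE c f x : (c *: f : homs M X) x = (c%:A : A) *: f x. Proof. by []. Qed.
Lemma homs_sumE (I : Type) (r : seq I) (P : pred I) (F : I -> homs M X) x :
  (\sum_(i <- r | P i) F i : homs M X) x = \sum_(i <- r | P i) F i x.
Proof. by elim/big_rec2: _ => // i y z _ <-. Qed.

(** A linear map is determined by the coordinates of the images of the generators,
    so the space of linear maps embeds into a space of matrices. *)
Lemma homs_fin_gen : fin_gen M -> fin_gen X -> fin_gen (homs M X).
Proof.
move=> [n [s sP]] /fin_gen_resk/kdimP[u uB].
have [v [uK vK]] := linear_inverse uB.
pose F (f : homs M X) := mxvec (\matrix_(i, j) v (f (s i) : resk X) 0 j).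
have FL : linear F.
  move=> c f g; rewrite /F -linearP; congr mxvec; apply/matrixP => i j.
  rewrite !mxE -[(c *: f + g) (s i)]/(c *: (f (s i) : resk X) + (g (s i) : resk X)).
  by rewrite linearP !mxE.
have [G GE] := linear_map_of FL; apply: (@fin_gen_inj _ _ _ G).
  by apply: has_dim_fin_gen; exists idfun; exists id.
move=> f g; rewrite !GE => /(can_inj mxvecK)/matrixP fg.
apply: homsP => x; have [c ->] := sP x; rewrite !linear_sum.
apply: eq_bigr => i _; rewrite !linearZ /=; congr (_ *: _).
apply: (can_inj vK); apply/rowP => j.
by have := fg i j; rewrite !mxE.
Qed.

End HomSpace.

Definition hom_dim M X : nat := kdim (homs M X).

Lemma hom_post M X Y (f : {linear X -> Y}) :
  exists F : {linear homs M X -> homs M Y}, forall g x, F g x = f (g x).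
Proof.
have FL : linear (fun g : homs M X => (f \o (g : {linear M -> X}) : {linear M -> Y}) : homs M Y).
  by move=> c g h; apply: homsP => x /=; rewrite linearP.
by have [F FE] := linear_map_of FL; exists F => g x; rewrite FE.
Qed.

Lemma hom_pre M N X (f : {linear M -> N}) :
  exists F : {linear homs N X -> homs M X}, forall g x, F g x = g (f x).
Proof.
have FL : linear (fun g : homs N X => ((g : {linear N -> X}) \o f : {linear M -> X}) : homs M X).
  by move=> c g h; apply: homsP => x.
by have [F FE] := linear_map_of FL; exists F => g x; rewrite FE.
Qed.

End Restriction.

(** * Vanishing of the first extension group *)
Section Extensions.
Context {R : pzRingType}.
Implicit Types E F K L M N X Y Z : lmodType R.

(** The pushout along [f] of the given sequence is an extension of [M] by [X]; a
    section of it yields a retraction, whose restriction to [F] extends [f]. *)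
Lemma ext1_zero_extend M X K F (i : {linear K -> F}) (p : {linear F -> M}) :
  short_exact i p -> ext1_zero M X ->
  forall f : {linear K -> X}, exists g : {linear F -> X}, forall x, g (i x) = f x.
Proof.
move=> [iI pS ip] MX f.
have pi x : p (i x) = 0 by apply/ip; exists x.
have [N NE] : exists N : submodClosed (X * F)%type,
    forall z, z \in N <-> exists x, z = (- f x, i x).
  apply: submod_of; first by exists 0; rewrite !linear0.
  move=> a _ _ [x ->] [y ->]; exists (a *: x + y).
  by rewrite !linearP.
(* [quotmod N] is the pushout, [j] and [r] below are its two maps. *)
pose q := quotmod_proj N; have qS : surjective_hom q := @quotmod_proj_surj _ _ N.
have q0 z : q z = 0 <-> exists x, z = (- f x, i x) by rewrite quotmod_proj0.
have [inl inlE] := linear_inl X F; have [inr inrE] := linear_inr X F.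
pose j : {linear X -> _} := q \o inl.
have jf x : j (f x) = q (inr (i x)).
  apply/esym/eqP; rewrite -subr_eq0; apply/eqP; rewrite -linearB; apply/q0; exists x.
  by rewrite inrE inlE; congr pair; rewrite /= ?sub0r ?subr0.
have [r rE] : exists r : {linear quotmod N -> M}, forall z, r (q z) = p z.2.
  apply: (@surj_factor _ _ _ _ q (p \o snd)) => // z /q0[x ->] /=.
  exact: pi.
have jr : short_exact j r.
  split.
  - apply/inj_linearP => x /q0[y]; rewrite inlE => -[-> y0].
    by rewrite (iI y 0) ?linear0.
  - by move=> m; have [y <-] := pS m; exists (q (0, y)); rewrite rE.
  move=> e; split=> [|[x <-]]; last by rewrite /j /= rE inlE linear0.
  have [[x y] <-] := qS e; rewrite rE => /ip[z /= zE].
  exists (x + f z); apply/eqP; rewrite -subr_eq0 -linearB; apply/eqP/q0.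
  exists (- z); rewrite inlE !linearN opprK zE; congr pair => /=.
    by rewrite addrAC subrr add0r.
  by rewrite sub0r.
have [s sK] := MX _ _ _ jr.
have [jI _ jrE] := jr.
have [g gE] : exists g : {linear F -> X}, forall y, j (g y) = subf (q \o inr) (s \o p) y.
  apply: inj_corestrict jI _ => y; apply/jrE.
  by rewrite linearB /= sK rE inrE subrr.
exists g => x; apply: jI; rewrite gE jf /= pi linear0 subr0 //.
Qed.

(** Converse of [ext1_zero_extend]: lift [p] to the middle term of an extension of
    [M] by [X], and correct the lift by an extension to [F] of its restriction to
    [K], so that it factors through [M]. *)
Lemma extend_ext1_zero M X K F (i : {linear K -> F}) (p : {linear F -> M}) :
  fin_gen M -> fin_gen X -> projective F -> short_exact i p ->
  (forall f : {linear K -> X}, exists g : {linear F -> X}, forall x, g (i x) = f x) ->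
  ext1_zero M X.
Proof.
move=> Mf Xf Fp [iI pS ip] iX E j q jq.
have pi x : p (i x) = 0 by apply/ip; exists x.
have [h hE] := Fp _ _ q p (fin_gen_extension Xf Mf jq) Mf (let: And3 _ qS _ := jq in qS).
have [jI _ jqE] := jq.
have qj x : q (j x) = 0 by apply/jqE; exists x.
have [f fE] : exists f : {linear K -> X}, forall x, j (f x) = (h \o i) x.
  by apply: inj_corestrict jI _ => x; apply/jqE; rewrite /= hE pi.
have [g gE] := iX f.
have [s sE] : exists s : {linear M -> E}, forall y, s (p y) = subf h (j \o g) y.
  apply: surj_factor => // y /ip[x <-].
  by rewrite /= gE fE subrr.
exists s => m; have [y <-] := pS m.
by rewrite sE linearB /= qj subr0 hE.
Qed.

(** The pullback of the sequence along [f] is an extension of [M] by [X]; it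
    splits, and a section of it is a lift of [f]. *)
Lemma ext1_zero_lift M X Y Z (i : {linear X -> Y}) (p : {linear Y -> Z}) :
  short_exact i p -> ext1_zero M X ->
  forall f : {linear M -> Z}, exists g : {linear M -> Y}, forall x, p (g x) = f x.
Proof.
move=> [iI pS ip] MX f.
have [N NE] : exists N : submodClosed (Y * M)%type,
    forall z, z \in N <-> p z.1 = f z.2.
  apply: submod_of => [|a [x m] [y n] /= xm yn]; first by rewrite !linear0.
  by rewrite !linearP xm yn.
have jL : linear (fun x : X => (i x, 0) : Y * M).
  by move=> a x y; congr pair; rewrite /= ?linearP ?scaler0 ?addr0.
(* [submod N] is the pullback. *)
have [j' j'E] := linear_map_of jL.
have [j jE] : exists j : {linear X -> submod N}, forall x, submod_incl N (j x) = j' x.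
  by apply: corestrict => x; apply/NE; rewrite j'E /= linear0; apply/ip; exists x.
pose q : {linear submod N -> M} := snd \o submod_incl N.
have qE z : q z = (submod_incl N z).2 by [].
have jq : short_exact j q.
  split.
  - by move=> x y /(congr1 (submod_incl N)); rewrite !jE !j'E => -[/iI].
  - move=> m; have [y yE] := pS (f m).
    have [z zE] : exists z, submod_incl N z = (y, m).
      by apply/submod_incl_surj/NE.
    by exists z; rewrite qE zE.
  move=> z; split=> [|[x <-]]; last by rewrite qE jE j'E.
  have /NE := submod_inclP z; rewrite qE; case zE: (submod_incl N z) => [y m] /= ym m0.
  move: ym; rewrite m0 linear0 => /ip[x xE].
  by exists x; apply: submod_incl_inj; rewrite jE j'E zE xE m0.
have [s sK] := MX _ _ _ jq.
exists (fst \o (submod_incl N \o s)) => m.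
by have /NE := submod_inclP (s m); rewrite -qE sK.
Qed.

End Extensions.

Section ExtVanishing.
Context {R : pzRingType}.
Implicit Types E F K L M N X Y Z : lmodType R.

Lemma ext1_zero_summand M N X : is_summand N M -> ext1_zero M X -> ext1_zero N X.
Proof.
move=> /summandP[s [r rK]] MX E j q jq.
have [t tE] := ext1_zero_lift jq MX r.
by exists (t \o s) => x /=; rewrite tE rK.
Qed.

(** Ext^2(M, -) vanishes, so Ext^1(M, -) is right exact: extend to the middle of
    the resolution a lift to [X] of a map from its kernel to [Y]. *)
Lemma ext1_zero_surj M X Y (g : {linear X -> Y}) :
  fin_gen M -> proj_dim_le1 M -> fin_gen X -> surjective_hom g ->
  ext1_zero M X -> ext1_zero M Y.
Proof.
move=> Mf [P1 [P0 [i [p [[P1f P1p] [P0f P0p] ip]]]]] Xf gS MX.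
have Yf := fin_gen_surj Xf gS.
apply: (extend_ext1_zero Mf Yf P0p ip) => f.
have [f' f'E] := P1p _ _ g f Xf Yf gS.
have [h hE] := ext1_zero_extend ip MX f'.
by exists (g \o h) => x /=; rewrite hE.
Qed.

Lemma ext1_zero_prodm M (I : finType) (X : I -> lmodType R) :
  fin_gen M -> proj_dim_le1 M -> (forall i, fin_gen (X i)) ->
  (forall i, ext1_zero M (X i)) -> ext1_zero M (prodm X).
Proof.
move=> Mf [P1 [P0 [i [p [[P1f P1p] [P0f P0p] ip]]]]] Xf MX.
apply: (extend_ext1_zero Mf (prodm_fin_gen Xf) P0p ip) => f.
pose ex j := cid (ext1_zero_extend ip (MX j) (prodm_proj X j \o f)).
pose g j : {linear P0 -> X j} := projT1 (ex j).
have gE j x : g j (i x) = f x j by rewrite /g; case: (ex j).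
have hL : linear (fun x => (fun j => g j x) : prodm X).
  by move=> a x y; apply: functional_extensionality_dep => j; rewrite linearP.
have [h hE] := linear_map_of hL; exists h => x; rewrite hE.
by apply: functional_extensionality_dep => j; apply: gE.
Qed.

(** In the long exact sequence of Hom(M, -), the group Ext^1(M, K) lies between
    the cokernel of Hom(M, X) -> Hom(M, Y), zero because all maps lift, and
    Ext^1(M, X). *)
Lemma ext1_zero_kernel M K X Y (i : {linear K -> X}) (g : {linear X -> Y}) :
  fin_gen M -> proj_dim_le1 M -> fin_gen K ->
  injective i -> (forall x, g x = 0 <-> exists z, i z = x) ->
  (forall f : {linear M -> Y}, exists h : {linear M -> X}, forall x, g (h x) = f x) ->
  ext1_zero M X -> ext1_zero M K.
Proof.
move=> Mf [P1 [P0 [j [p [[P1f P1p] [P0f P0p] jp]]]]] Kf iI ig gl MX.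
apply: (extend_ext1_zero Mf Kf P0p jp) => f.
have [e eE] := ext1_zero_extend jp MX (i \o f).
have [_ pS jpE] := jp.
have pj x : p (j x) = 0 by apply/jpE; exists x.
have gi x : g (i x) = 0 by apply/ig; exists x.
have [m mE] : exists m : {linear M -> Y}, forall y, m (p y) = (g \o e) y.
  by apply: surj_factor pS _ => y /jpE[x <-]; rewrite /= eE /= gi.
have [m' m'E] := gl m.
have [h hE] : exists h : {linear P0 -> K}, forall y, i (h y) = subf e (m' \o p) y.
  by apply: inj_corestrict iI _ => y; apply/ig; rewrite linearB /= m'E mE subrr.
by exists h => x; apply: iI; rewrite hE /= pj linear0 subr0 eE.
Qed.

Lemma row_projective (S : nzRingType) m : projective ('rV[S]_m : lmodType S).
Proof.
move=> X Y g f _ _ gS; have [s sE] := choice gS.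
have [h hE] := rV_lift (fun j => s (f (delta_mx 0 j))).
exists h => u; rewrite hE linear_sum [in RHS](row_sum_delta u) linear_sum.
by apply: eq_bigr => i _; rewrite !linearZ /= sE.
Qed.

Lemma row_fin_gen (S : nzRingType) m : fin_gen ('rV[S]_m : lmodType S).
Proof. by exists m, (fun j => delta_mx 0 j) => u; exists (u 0); apply: row_sum_delta. Qed.

End ExtVanishing.

Section ProjDim.
Context {k : fieldType} {A : falgType k}.
Implicit Types E F K L M N X Y Z T : lmodType A.

(** Let [q] be a surjection from a free module [F] onto [X], and [K] its kernel.
    Lifting the retraction and the section between [T] and [X] to the resolutions
    gives [a] and [b] whose composite [a \o b] lifts the identity of [X]; so
    [a \o b] differs from the identity of [F] by a map [h] into [K].  So the
    identity of [K] is a map through the projective module [P1] minus the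
    restriction to [K] of [h].  Maps from [P1] and from [F] lift along surjections,
    hence so do maps from [K]. *)
Lemma proj_dim_le1_summand T X : fin_gen X ->
  proj_dim_le1 T -> is_summand X T -> fin_gen T -> proj_dim_le1 X.
Proof.
move=> Xf [P1 [P0 [i [p [[P1f P1p] [P0f P0p] [iI pS ip]]]]]] /summandP[s [r rK]] Tf.
have pi x : p (i x) = 0 by apply/ip; exists x.
have [m [t tP]] := Xf; have [q qE] := rV_lift t.
have qS : surjective_hom q.
  move=> x; have [c ->] := tP x; exists (\row_j c j); rewrite qE.
  by apply: eq_bigr => j _; rewrite mxE.
have Fp := @row_projective A m; have Ff := @row_fin_gen A m.
have [K [j [jI jq]]] := linear_kernel q.
have qj x : q (j x) = 0 by apply/jq; exists x.
have [a aE] := P0p _ _ q (r \o p) Ff Xf qS.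
have [b bE] := Fp _ _ p (s \o q) P0f Tf pS.
have [a1 a1E] : exists a1 : {linear P1 -> K}, forall x, j (a1 x) = (a \o i) x.
  by apply: inj_corestrict jI _ => x; apply/jq; rewrite /= aE /= pi linear0.
have [b1 b1E] : exists b1 : {linear K -> P1}, forall x, i (b1 x) = (b \o j) x.
  by apply: inj_corestrict iI _ => x; apply/ip; rewrite /= bE /= qj linear0.
have [h hE] : exists h : {linear 'rV[A]_m -> K}, forall x, j (h x) = subf (a \o b) idfun x.
  apply: inj_corestrict jI _ => x; apply/jq.
  by rewrite linearB /= aE /= bE /= rK subrr.
have Kf : fin_gen K by apply: fin_gen_submod Ff jI.
exists K, 'rV[A]_m, j, q; split=> //; split=> // Y Z g f Yf Zf gS.
have [c cE] := P1p _ _ g (f \o a1) Yf Zf gS.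
have [d dE] := Fp _ _ g (f \o h) Yf Zf gS.
exists (subf (c \o b1) (d \o j)) => x.
rewrite linearB /= cE dE /= -linearB; congr (f _); apply: jI.
by rewrite linearB a1E /= b1E hE /= opprB addrC subrK.
Qed.

End ProjDim.

(** * Dimensions of spaces of homomorphisms *)
Section HomDimension.
Context {k : fieldType} {A : falgType k}.
Implicit Types F K L M N P X Y Z T : lmodType A.

Lemma resk_short_exact_kdim X Y Z (i : {linear X -> Y}) (p : {linear Y -> Z}) :
  fin_gen X -> fin_gen Z -> short_exact i p ->
  kdim (resk Y) = (kdim (resk X) + kdim (resk Z))%N.
Proof.
move=> /fin_gen_resk Xf /fin_gen_resk Zf [iI pS ip].
have [i' i'E] := resk_map i; have [p' p'E] := resk_map p.
apply: (short_exact_kdim (f := i') (g := p')) => //; split.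
- by move=> x y; rewrite !i'E; apply: iI.
- by move=> z; have [y <-] := pS z; exists y; rewrite p'E.
move=> y; rewrite p'E; split=> [/ip[x xE]|[x xE]]; first by exists x; rewrite i'E.
by apply/ip; exists x; rewrite -i'E.
Qed.

Lemma hom_dim_left_exact M X Y Z (i : {linear X -> Y}) (p : {linear Y -> Z}) :
  fin_gen M -> fin_gen Y -> fin_gen Z -> injective i ->
  (forall y, p y = 0 <-> exists x, i x = y) ->
  (hom_dim M Y <= hom_dim M X + hom_dim M Z)%N /\
  (hom_dim M Y = (hom_dim M X + hom_dim M Z)%N <->
   forall f : {linear M -> Z}, exists g : {linear M -> Y}, forall x, p (g x) = f x).
Proof.
move=> Mf Yf Zf iI ip; have [i' i'E] := hom_post M i; have [p' p'E] := hom_post M p.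
have := @left_exact_kdim _ _ _ _ i' p' (homs_fin_gen Mf Yf) (homs_fin_gen Mf Zf).
case=> [f g fg|g|le eq].
- by apply: homsP => x; apply: iI; rewrite -!i'E fg.
- split=> [pg|[f <-]]; last first.
    by apply: homsP => x; rewrite p'E i'E homs_0E; apply/ip; exists (f x).
  have [f fE] : exists f : {linear M -> X}, forall x, i (f x) = g x.
    by apply: inj_corestrict => // x; apply/ip; rewrite -p'E pg.
  by exists f; apply: homsP => x; rewrite i'E.
split=> //; rewrite eq; split=> [pS f|pS f].
  by have [g gE] := pS f; exists g => x; rewrite -p'E gE.
by have [g gE] := pS f; exists g; apply: homsP => x; rewrite p'E.
Qed.

Lemma hom_dim_resolution M K F X (i : {linear K -> F}) (p : {linear F -> M}) :
  fin_gen K -> fin_gen F -> fin_gen X -> short_exact i p -> ext1_zero M X ->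
  hom_dim F X = (hom_dim M X + hom_dim K X)%N.
Proof.
move=> Kf Ff Xf ip MX; have ext := ext1_zero_extend ip MX; have [iI pS ipE] := ip.
have Mf := fin_gen_surj Ff pS.
have [i' i'E] := hom_pre X i; have [p' p'E] := hom_pre X p.
have := @left_exact_kdim _ _ _ _ p' i' (homs_fin_gen Ff Xf) (homs_fin_gen Kf Xf).
case=> [f g fg|g|_ ->].
- by apply: homsP => m; have [y <-] := pS m; rewrite -!p'E fg.
- split=> [ig|[f <-]]; last first.
    by apply: homsP => x; rewrite i'E p'E homs_0E (ipE _).2 ?linear0 //; exists x.
  have [f fE] : exists f : {linear M -> X}, forall y, f (p y) = g y.
    by apply: surj_factor => // y /ipE[x <-]; rewrite -i'E ig.
  by exists f; apply: homsP => x; rewrite p'E.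
by move=> f; have [g gE] := ext f; exists g; apply: homsP => x; rewrite i'E.
Qed.

Lemma hom_dim_bij M X Y (f : {linear X -> Y}) :
  fin_gen M -> fin_gen Y -> bijective f -> hom_dim M X = hom_dim M Y.
Proof.
move=> Mf Yf /linear_inverse[g [fK gK]]; have [F FE] := hom_post M f; have [G GE] := hom_post M g.
apply: (kdim_bij (f := F) (homs_fin_gen Mf Yf)).
by exists G => h; apply: homsP => x; rewrite ?(FE, GE) ?(FE, GE).
Qed.

End HomDimension.

(** * Composition factors over a bound quiver *)
Section CompositionFactors.
Context {k : fieldType} {A : falgType k} {Q : quiver} (pres : bound_quiver A Q).
Implicit Types M P X Y Z : lmodType A.
Let e := bq_e pres.
Let v := bq_v pres.

Let eM a b : e a * e b = if a == b then e a else 0 := bq_orth pres a b.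
Let ve x : v x * e (source x) = v x := bq_source pres x.
Let ev x : e (target x) * v x = v x := bq_target pres x.

(** A vector spanning a copy of the simple module at the vertex [a]. *)
Definition vertex_vector X (a : Q) (y : X) : Prop :=
  [/\ y != 0, e a *: y = y & forall x, v x *: y = 0].

(** [path_eval] for an arbitrary sequence of arrows, composable or not. *)
Definition path_value (a : Q) (s : seq (arrow Q)) : A := foldl (fun w x => v x * w) (e a) s.

Definition path_end (a : Q) (s : seq (arrow Q)) : Q := last a (map (@target Q) s).

Lemma path_value_rcons a s x : path_value a (rcons s x) = v x * path_value a s.
Proof. by rewrite /path_value -cats1 foldl_cat. Qed.

Lemma is_path_rcons (a : Q) s x :
  is_path a (rcons s x) = is_path a s && (source x == path_end a s).
Proof.
elim: s a => [|y s IH] a /=; first by rewrite andbT.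
by rewrite IH andbA.
Qed.

Lemma path_value_end a s : e (path_end a s) * path_value a s = path_value a s.
Proof.
elim/last_ind: s => [|s x _]; first by rewrite /path_value /= eM eqxx.
by rewrite path_value_rcons /path_end map_rcons last_rcons mulrA ev.
Qed.

Lemma path_value_bound : exists N, forall a s,
  is_path a s -> (N <= size s)%N -> path_value a s = 0.
Proof.
have [N _ NP] := bq_ge pres; exists N => a s sP sN.
exact: (NP (exist (fun p : Q * seq (arrow Q) => is_path p.1 p.2) (a, s) sP) sN).
Qed.

(** Long paths act as zero, so among the paths that do not kill a given nonzero
    vector there is one of maximal length; its value on the vector is killed by
    all arrows. *)
Lemma vertex_vector_exists X : ~ is_zero_mod X -> exists a (y : X), vertex_vector a y.
Proof.
move=> X0; have [y0 y00] : exists y : X, y != 0.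
  by apply: contrapT => no; apply: X0 => y; apply/eqP; apply: contrapT => /negP yn; apply: no; exists y.
pose T n := `[< exists a s, [/\ is_path a s, size s = n & path_value a s *: y0 != 0] >].
have exT : exists n, T n.
  have [a ya] : exists a, e a *: y0 != 0.
    apply: contrapT => no; move/eqP: y00; apply.
    rewrite -[y0]scale1r -(bq_sum1 pres) scaler_suml big1 // => a _.
    by apply/eqP; apply: contrapT => /negP yn; apply: no; exists a.
  by exists 0%N; apply/asboolP; exists a, [::].
have [N NP] := path_value_bound.
have TN n : T n -> (n <= N)%N.
  move=> /asboolP[a [s [sP <- sy]]]; rewrite leqNgt; apply/negP => /ltnW/(NP _ _ sP) s0.
  by move: sy; rewrite s0 scale0r eqxx.
case: (ex_maxnP exT TN) => n /asboolP[a [s [sP sn sy]]] nmax.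
exists (path_end a s), (path_value a s *: y0); split=> // [|x].
  by rewrite scalerA path_value_end.
apply/eqP; apply: contrapT => /negP xy.
(* An arrow that does not start at the end of the path kills its value anyway. *)
have sx : source x == path_end a s.
  apply: contraT => sx; move: xy.
  rewrite scalerA -ve -path_value_end mulrA.
  by rewrite -(mulrA (v x)) eM (negPf sx) mulr0 mul0r scale0r eqxx.
have /nmax : T n.+1; last by rewrite ltnn.
apply/asboolP; exists a, (rcons s x); split; rewrite ?size_rcons ?sn //.
  by rewrite is_path_rcons sP.
by rewrite path_value_rcons -scalerA.
Qed.

(** Only the trivial path at [a] acts nontrivially on a vertex vector at [a]: the
    scalar is its coefficient in an expression of [u] by paths, hence the same for
    all modules and all vertex vectors at [a]. *)
Lemma vertex_vector_scalar (a : Q) (u : A) : exists c : k,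
  forall X (y : X), vertex_vector a y -> u *: y = (c%:A : A) *: y.
Proof.
have [s [c ->]] := bq_surj pres u.
exists (\sum_(p <- s) if (size (val p).2 == 0%N) && ((val p).1 == a) then c p else 0).
move=> X y [_ ya yv]; rewrite !scaler_suml.
have v0 a' x s' : foldl (fun w x => v x * w) (v x * e a') s' *: y = 0.
  elim/last_ind: s' => [|s' z IH] /=; last by rewrite -cats1 foldl_cat /= -scalerA IH scaler0.
  rewrite -scalerA; have [->|aa] := eqVneq a' a; first by rewrite ya yv.
  by rewrite -ya (scalerA (e a')) eM (negPf aa) scale0r scaler0.
apply: eq_bigr => -[[a' s'] pP] _; rewrite /path_eval -/e -/v /= -[X in X *: y = _]mulr_algl -scalerA.
case: s' pP => [|x s'] pP /=; last by rewrite v0 scaler0 !scale0r.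
have [->|aa] := eqVneq a' a; first by rewrite ya.
by rewrite -ya (scalerA (e a')) eM (negPf aa) !scale0r scaler0.
Qed.

Lemma scalar_vector_line X (y : X) (l : A -> k) :
  (forall u, u *: y = ((l u)%:A : A) *: y) -> forall u c d,
  u *: ((c%:A : A) *: y) + (d%:A : A) *: y = ((l u * c + d)%:A : A) *: y.
Proof.
move=> lE u c d; rewrite scalerDl scalerDl; congr (_ + _).
by rewrite scalerA -(scalar_algM c u) -(scalerA c%:A u y) lE (scalerA c%:A) mulr_algl scalerA mulrC.
Qed.

Lemma scalar_vector_inj X (y : X) (c d : k) : y != 0 ->
  (c%:A : A) *: y = (d%:A : A) *: y -> c = d.
Proof.
move=> y0 /eqP; rewrite -subr_eq0 -scalerBl -scalerBl => /eqP cd.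
apply/eqP; rewrite -subr_eq0; apply: contraT => cd0; case/eqP: y0.
by rewrite -[y]scale1r -[1](scale1r (1 : A)) -[X in X *: 1](mulVf cd0) -scalerA
  -[(c - d)%:A]mul1r scalerAl -scalerA cd scaler0.
Qed.

Definition simple_at (a : Q) X : Prop :=
  exists2 y : X, vertex_vector a y & forall z, exists c : k, z = (c%:A : A) *: y.

Lemma simple_at_isomorphic a X Y : simple_at a X -> simple_at a Y -> isomorphic X Y.
Proof.
move=> [x xa xs] [y ya ys]; have [c cE] := choice xs; have [d dE] := choice ys.
have [lam lamE] := choice (vertex_vector_scalar a).
have [x0 _ _] := xa; have [y0 _ _] := ya.
have fL : linear (fun z => ((c z)%:A : A) *: y).
  move=> u z w /=.
  have -> : c (u *: z + w) = lam u * c z + c w.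
    apply: (scalar_vector_inj x0); rewrite -cE {1}(cE z) {1}(cE w).
    by apply: scalar_vector_line => t; apply: lamE.
  by rewrite (scalar_vector_line (fun t => lamE t _ _ ya)).
have [f fE] := linear_map_of fL; exists f; exists (fun z => ((d z)%:A : A) *: x) => z.
  by rewrite fE [RHS]cE; congr (_ *: _); congr (_ *: _); apply: (scalar_vector_inj y0); rewrite -dE.
by rewrite fE [RHS]dE; congr (_ *: _); congr (_ *: _); apply: (scalar_vector_inj x0); rewrite -cE.
Qed.

(** The dimension of Hom(P, S_a), with the value 0 if no module is simple at [a].
    For projective [P] it is the multiplicity of P_a in [P]. *)
Definition top_mult P (a : Q) : nat :=
  if pselect (exists X, simple_at a X) is left ex then hom_dim P (projT1 (cid ex)) else 0%N.

Lemma simple_at_fin_gen a X : simple_at a X -> fin_gen X.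
Proof.
move=> [y _ ys]; exists 1%N, (fun=> y) => x; have [c ->] := ys x.
by exists (fun=> c%:A); rewrite big_ord1.
Qed.

Lemma top_multE P a X : fin_gen P -> simple_at a X -> hom_dim P X = top_mult P a.
Proof.
move=> Pf Xa; rewrite /top_mult; case: pselect => [ex|[]]; last by exists X.
case: cid => /= Y Ya; have [f fB] := simple_at_isomorphic Xa Ya.
exact: hom_dim_bij Pf (simple_at_fin_gen Ya) fB.
Qed.

Definition dim_vector X (x : Q -> nat) : Prop :=
  forall P, fin_gen P -> projective P -> hom_dim P X = (\sum_a top_mult P a * x a)%N.

(** Hom(P, -) is exact for projective [P], so dimensions add up along a composition
    series; [x a] counts the factors isomorphic to S_a.  The induction splits off
    the line spanned by a vertex vector. *)
Lemma dim_vector_exists X : fin_gen X -> exists x : Q -> nat,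
  (~ is_zero_mod X -> exists a, x a != 0%N) /\ dim_vector X x.
Proof.
have [n] := ubnP (kdim (resk X)); elim: n X => // n IH X Xn Xf.
have [X0|X0] := pselect (is_zero_mod X).
  exists (fun=> 0%N); split=> // P Pf Pp; rewrite big1 => [|a _]; last by rewrite muln0.
  by apply: kdim_zero => f; apply: homsP => x; rewrite (X0 (f x)) homs_0E.
have [a [y ya]] := vertex_vector_exists X0; have [y0 yv ay] := ya.
have [lam lamE] := choice (vertex_vector_scalar a).
have [N NE] : exists N : submodClosed X, forall x, x \in N <-> exists c : k, x = (c%:A : A) *: y.
  apply: submod_of => [|u _ _ [c ->] [d ->]]; first by exists 0; rewrite scale0r scale0r.
  by exists (lam u * c + d); apply: scalar_vector_line => t; apply: lamE.
pose i := submod_incl N; have iI : injective i := @submod_incl_inj _ _ N.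
have iZ u z : i (u *: z) = u *: i z by rewrite linearZ.
have [y' y'E] : exists y', i y' = y.
  by apply/submod_incl_surj/NE; exists 1; rewrite !scale1r.
have Na : simple_at a (submod N).
  exists y'; last first.
    move=> z; have /NE[c cE] := submod_inclP z; exists c; apply: iI.
    by rewrite iZ y'E.
  split; first by apply: contra_neq y0 => y'0; rewrite -y'E y'0 linear0.
    by apply: iI; rewrite iZ y'E.
  by move=> x; apply: iI; rewrite iZ y'E linear0 ay.
have Nf := simple_at_fin_gen Na.
pose p := quotmod_proj N; have pS : surjective_hom p := @quotmod_proj_surj _ _ N.
have Qf := fin_gen_surj Xf pS.
have ip : short_exact i p.
  split=> // x; rewrite quotmod_proj0; split=> [|[z <-]]; first exact: submod_incl_surj.
  exact: submod_inclP.
have /IH[] // : (kdim (resk (quotmod N)) < n)%N.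
  rewrite -ltnS; apply: leq_trans Xn; rewrite ltnS (resk_short_exact_kdim Nf Qf ip).
  rewrite -add1n leq_add2r lt0n; apply/eqP => /(kdim0P ((fin_gen_resk _).1 Nf)) N0.
  by move: y0; rewrite -y'E (N0 y') linear0 eqxx.
move=> x [_ xE]; exists (fun b => (x b + (b == a))%N); split.
  by move=> _; exists a; rewrite eqxx addn1.
move=> P Pf Pp.
have [_ [_ ->]] := hom_dim_left_exact Pf Xf Qf iI (let: And3 _ _ E := ip in E); last first.
  by move=> f; apply: Pp.
rewrite (top_multE Pf Na) xE // (eq_bigr _ (fun b _ => mulnDr _ _ _)) big_split /= addnC.
congr addn; rewrite (bigD1 a) //= eqxx muln1 big1 ?addn0 // => b /negPf->.
by rewrite muln0.
Qed.

End CompositionFactors.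

(** * Indecomposable modules and Fitting's lemma *)
Section Retracts.
Context {R : pzRingType}.
Implicit Types K M N X Y : lmodType R.

Lemma split_isomorphic M N K (s : {linear M -> N}) (i : {linear K -> N}) :
  (forall y, exists m z, y = s m + i z) ->
  (forall m z, s m + i z = 0 -> m = 0 /\ z = 0) -> isomorphic N (M * K)%type.
Proof.
move=> gen dir.
have gL : linear (fun x : M * K => s x.1 + i x.2).
  by move=> a x y; rewrite !linearP scalerDr addrACA.
have [g gE] := linear_map_of gL.
have /linear_inverse[h [gK hK]] : bijective g; last by exists h; exists g.
apply: inj_surj_bij; last first.
  by move=> y; have [m [z ->]] := gen y; exists (m, z); rewrite gE.
by apply/inj_linearP => -[m z]; rewrite gE => /dir[/= -> ->].
Qed.

(** [N] is the direct sum of the image of [s] and the kernel of [r]. *)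
Lemma retract_indecomposable M N (s : {linear M -> N}) (r : {linear N -> M}) :
  indecomposable N -> ~ is_zero_mod M -> (forall x, r (s x) = x) -> bijective s.
Proof.
move=> [_ Nind] M0 rs; have [K [i [iI ri]]] := linear_kernel r.
have ri0 z : r (i z) = 0 by apply/ri; exists z.
have /Nind[//|K0] : isomorphic N (M * K)%type.
  apply: (@split_isomorphic _ _ _ s i) => [y|m z smz].
    have [z zE] : exists z, i z = y - s (r y) by apply/ri; rewrite linearB rs subrr.
    by exists (r y), z; rewrite zE addrC subrK.
  have m0 : m = 0.
    by move/(congr1 r): smz; rewrite linearD rs ri0 addr0 linear0.
  by move: smz; rewrite m0 linear0 add0r -(linear0 i) => /iI.
exists r => // y; have [z zE] : exists z, i z = y - s (r y).
  by apply/ri; rewrite linearB rs subrr.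
by move/eqP: zE; rewrite (K0 z) linear0 eq_sym subr_eq0 => /eqP.
Qed.

Lemma idempotent_indecomposable Y (e : {linear Y -> Y}) : indecomposable Y ->
  (forall y, e (e y) = e y) -> (exists y, e y <> 0) -> forall y, e y = y.
Proof.
move=> Yi ee [y0 ey0]; have [Z [h [j [hS jI hE]]]] := linear_image e.
have hj z : h (j z) = z.
  by have [y <-] := hS z; apply: jI; rewrite !hE ee.
have Z0 : ~ is_zero_mod Z by move=> Z0; apply: ey0; rewrite -hE (Z0 (h y0)) linear0.
have [j' _ jK] := retract_indecomposable Yi Z0 hj.
by move=> y; rewrite -hE -[y]jK hj.
Qed.

Lemma iter_linear M (f : {linear M -> M}) n : exists F : {linear M -> M}, F =1 iter n f.
Proof.
apply: linear_map_of; elim: n => [//|n IH a x y] /=.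
by rewrite IH linearP.
Qed.

End Retracts.

Section LocalEndomorphisms.
Context {k : fieldType} {A : falgType k}.
Implicit Types K M N X Y Z T : lmodType A.

Lemma module_inj_surj X Y (f : {linear X -> Y}) :
  fin_gen Y -> injective f -> (kdim (resk Y) <= kdim (resk X))%N -> surjective_hom f.
Proof.
move=> /fin_gen_resk Yf fI YX y; have [g gE] := resk_map f.
have gI : injective g by move=> u w; rewrite !gE; apply: fI.
by have [x xE] := kdim_inj_surj Yf gI YX y; exists x; rewrite -gE.
Qed.

Lemma endo_inj_bij M (f : {linear M -> M}) : fin_gen M -> injective f -> bijective f.
Proof.
by move=> Mf fI; apply: inj_surj_bij => //; apply: module_inj_surj.
Qed.

(** For [n] such that the kernel of the [n]-th iterate is maximal, [M] is the
    direct sum of the kernel and of the image of this iterate. *)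
Lemma fitting M (f : {linear M -> M}) : fin_gen M -> indecomposable M ->
  bijective f \/ exists n, forall x, iter n f x = 0.
Proof.
move=> Mf [_ Mind].
pose T d := `[< exists n K (i : {linear K -> M}), [/\ injective i,
  forall x, iter n f x = 0 <-> exists z, i z = x & kdim (resk K) = d] >].
have exT : exists d, T d.
  have [F FE] := iter_linear f 0; have [K [i [iI Ki]]] := linear_kernel F.
  by exists (kdim (resk K)); apply/asboolP; exists 0%N, K, i; split=> // x; rewrite -FE Ki.
have Tb d : T d -> (d <= kdim (resk M))%N.
  move=> /asboolP[n [K [i [iI _ <-]]]]; have [i' i'E] := resk_map i.
  by apply: (kdim_inj (f := i') ((fin_gen_resk _).1 Mf)) => x y; rewrite !i'E; apply: iI.
case: (ex_maxnP exT Tb) => d /asboolP[n [K [i [iI Ki Kd]]]] dmax.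
have Kf : fin_gen K by apply: fin_gen_submod iI.
have stable m x : iter (m + n) f x = 0 -> iter n f x = 0.
  have [F FE] := iter_linear f (m + n); have [L [j [jI Lj]]] := linear_kernel F.
  have [h hE] : exists h : {linear K -> L}, forall z, j (h z) = i z.
    apply: inj_corestrict => // z; apply/Lj; rewrite FE iterD (Ki (i z)).2; last by exists z.
    by have [G GE] := iter_linear f m; rewrite -GE linear0.
  have hI : injective h by move=> u w /(congr1 j); rewrite !hE => /iI.
  have /(module_inj_surj (fin_gen_submod Mf jI) hI) hS : (kdim (resk L) <= kdim (resk K))%N.
    by rewrite Kd; apply: dmax; apply/asboolP; exists (m + n)%N, L, j; split=> // y; rewrite -FE Lj.
  rewrite -FE => /Lj[y <-]; have [z <-] := hS y.
  by apply/Ki; exists z; rewrite hE.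
have [F FE] := iter_linear f n.
have [N [h [j [hS jI hE]]]] := linear_image F.
have Nf : fin_gen N by apply: fin_gen_submod jI.
have ih : short_exact i h.
  split=> // x; rewrite -Ki -FE -hE.
  by split=> [->|e]; [rewrite linear0|apply: jI; rewrite e linear0].
have gL : linear (fun x : K * N => i x.1 + j x.2).
  by move=> a x y; rewrite !linearP scalerDr addrACA.
have [g gE] := linear_map_of gL.
have gI : injective g.
  apply/inj_linearP => -[z y]; rewrite gE /= => zy.
  have [x xE] : exists x, F x = j y by have [x <-] := hS y; exists x; rewrite hE.
  have iz0 : iter n f (i z) = 0 by apply/Ki; exists z.
  have Fz : F (F x) = 0.
    move/(congr1 F): zy; rewrite linearD linear0 FE iz0 add0r -xE.
    by rewrite FE.
  have j0 : j y = 0.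
    by rewrite -xE FE; apply: (stable n); rewrite iterD -!FE.
  move: zy; rewrite j0 addr0 -(linear0 i) => /iI ->.
  by move: j0; rewrite -(linear0 j) => /jI ->.
have [inl inlE] := linear_inl K N.
have KNe : short_exact inl (snd : {linear (K * N)%type -> N}).
  split; first by move=> x y; rewrite !inlE => -[].
    by move=> y; exists (0, y).
  move=> [x y] /=; split=> [->|[z]]; first by exists x; rewrite inlE.
  by rewrite inlE => -[].
have gS : surjective_hom g.
  apply: module_inj_surj => //.
  by rewrite (resk_short_exact_kdim Kf Nf ih) (resk_short_exact_kdim Kf Nf KNe).
have /linear_inverse[g' [gK g'K]] := inj_surj_bij gI gS.
have [K0|N0] := Mind _ _ (ex_intro _ g' (Bijective g'K gK)).
  left; apply: endo_inj_bij => //; apply/inj_linearP => x fx0.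
  have : iter n f x = 0.
    apply: (stable 1%N); rewrite addnC iterD /= fx0.
    by have [G GE] := iter_linear f n; rewrite -GE linear0.
  by move=> /Ki[z <-]; rewrite (K0 z) linear0.
by right; exists n => x; rewrite -FE -hE (N0 (h x)) linear0.
Qed.

Lemma local_add M (f g : {linear M -> M}) : fin_gen M -> indecomposable M ->
  (forall x, f x + g x = x) -> bijective f \/ bijective g.
Proof.
move=> Mf Mi fg; have [|[n fn]] := fitting f Mf Mi; first by left.
right; apply: endo_inj_bij => //; apply/inj_linearP => x gx.
have fx : f x = x by rewrite -[RHS]fg gx addr0.
rewrite -(fn x); elim: n {fn} => //= n <-; by rewrite fx.
Qed.

(** In a local ring, a sum of non-units is not a unit. *)
Lemma local_sum M (I : Type) (r : seq I) (f : I -> homs M M) :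
  fin_gen M -> indecomposable M ->
  bijective (\sum_(i <- r) f i : homs M M) -> exists i, bijective (f i).
Proof.
move=> Mf Mi; elim: r => [|i r IH].
  rewrite big_nil => -[g gK _]; case: Mi => M0 _; case: M0 => x.
  by rewrite -[x]gK -[RHS]gK !homs_0E.
rewrite big_cons; set h := \sum_(j <- r) f j in IH *.
move=> /linear_inverse[g [gK Kg]].
have gfh x : (g \o (f i : {linear M -> M})) x + (g \o (h : {linear M -> M})) x = x.
  by rewrite /= -linearD -homs_addE gK.
have [[g1 K1 K1']|[g1 K1 K1']] := local_add Mf Mi gfh.
  exists i; exists (g1 \o g) => x /=; first exact: K1.
  by apply: (can_inj Kg); apply: K1'.
apply: IH; exists (g1 \o g) => x /=; first exact: K1.
by apply: (can_inj Kg); apply: K1'.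
Qed.

Lemma indecomposable_factor M N (b : {linear M -> N}) (a : {linear N -> M}) :
  indecomposable M -> indecomposable N -> bijective (a \o b) -> isomorphic M N.
Proof.
move=> [M0 _] Ni /linear_inverse[t [tK Kt]]; exists b.
by apply: (@retract_indecomposable _ _ _ b (t \o a)) => // x; apply: tK.
Qed.

End LocalEndomorphisms.

(** * Approximations and traces *)
Section Approximation.
Context {k : fieldType} {A : falgType k}.
Implicit Types K M N X Y Z T : lmodType A.

(** The source of the approximation has one factor [N j] for every element of a
    basis of Hom(N j, Y), mapped to [Y] by this basis element. *)
Lemma right_approximation (J : finType) (N : J -> lmodType A) Y :
  (forall j, fin_gen (N j)) -> fin_gen Y ->
  exists (I : finType) (r : I -> J) (u : {linear prodm (fun i => N (r i)) -> Y}),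
  forall j (f : {linear N j -> Y}), exists h : {linear N j -> prodm (fun i => N (r i))},
    forall x, u (h x) = f x.
Proof.
move=> Nf Yf; pose bas j := cid (kdimP (homs_fin_gen (Nf j) Yf)).
pose beta j : {linear 'rV[k]_(hom_dim (N j) Y) -> homs (N j) Y} := projT1 (bas j).
have betaB j : bijective (beta j) by rewrite /beta; case: (bas j).
pose I : finType := {j : J & 'I_(hom_dim (N j) Y)}.
pose b (p : I) : {linear N (tag p) -> Y} := beta (tag p) (delta_mx 0 (tagged p)).
have [u _ uE] := prodm_copair b.
exists I, (fun p => tag p), u => j f.
have [g _ gK] := betaB j.
pose c := g f.
pose tg t : I := existT (fun j => 'I_(hom_dim (N j) Y)) j t.
pose h : homs (N j) (prodm (fun p : I => N (tag p))) :=
  \sum_t c 0 t *: (prodm_inj (fun p : I => N (tag p)) (tg t) : homs (N j) _).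
exists h => x; rewrite homs_sumE linear_sum.
rewrite -[f]/(f : homs (N j) Y) -[f in RHS]gK (row_sum_delta (g f)) linear_sum homs_sumE.
by apply: eq_bigr => t _; rewrite homs_scaleE linearZ linearZ /= homs_scaleE (uE (tg t)).
Qed.

Definition generated T X : Prop :=
  exists (I : finType) (u : {linear prodm (fun _ : I => T) -> X}), surjective_hom u.

Lemma generated_ext1_zero T X : fin_gen T -> proj_dim_le1 T -> ext1_zero T T ->
  generated T X -> ext1_zero T X.
Proof.
move=> Tf Tp TT [I [u uS]]; apply: (ext1_zero_surj Tf Tp _ uS).
  exact: prodm_fin_gen.
exact: ext1_zero_prodm.
Qed.

(** The trace is the image of the approximation of [X] by powers of [T]. *)
Lemma trace_submodule T X : fin_gen T -> fin_gen X ->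
  exists N (j : {linear N -> X}), [/\ injective j, generated T N &
    forall f : {linear T -> X}, exists g : {linear T -> N}, forall t, j (g t) = f t].
Proof.
move=> Tf Xf; have [I [r [u uE]]] := @right_approximation unit (fun=> T) X (fun=> Tf) Xf.
have [N [h [j [hS jI hE]]]] := linear_image u.
exists N, j; split=> // [|f]; first by exists I, h.
by have [m mE] := uE tt f; exists (h \o m) => t /=; rewrite hE mE.
Qed.

End Approximation.

(** * The torsion class of a tilting module *)
Section TiltingTorsion.
Context {k : fieldType} {A : falgType k} {Q : quiver} (pres : bound_quiver A Q).
Implicit Types K M X Y Z W T : lmodType A.

(** A resolution 0 -> K -> F -> M -> 0 by projectives gives
    [M, Z] = [F, Z] - [K, Z] when Ext^1(M, Z) = 0, and both terms on the right
    are linear in the dimension vector of [Z]. *)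
Lemma hom_dim_linear M : fin_gen M -> proj_dim_le1 M -> exists g : Q -> int,
  forall Z z, fin_gen Z -> ext1_zero M Z -> dim_vector pres Z z ->
    (hom_dim M Z)%:Z = \sum_a g a * (z a)%:Z.
Proof.
move=> Mf [K [F [i [p [[Kf Kp] [Ff Fp] ip]]]]].
exists (fun a => (top_mult pres F a)%:Z - (top_mult pres K a)%:Z) => Z z Zf MZ zE.
have /(congr1 Posz) := hom_dim_resolution Kf Ff Zf ip MZ.
rewrite PoszD (zE K) // (zE F) // => e.
have -> : (hom_dim M Z)%:Z =
    (\sum_a top_mult pres F a * z a)%N%:Z - (\sum_a top_mult pres K a * z a)%N%:Z.
  by rewrite e addrK.
rewrite !(big_morph Posz PoszD (erefl _)) -sumrB; apply: eq_bigr => a _.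
by rewrite !PoszM mulrBl.
Qed.

Lemma hom_dim_zero M X : hom_zero M X -> hom_dim M X = 0%N.
Proof. by move=> MX; apply: kdim_zero => f; apply: homsP => x; apply: MX. Qed.

(** A singular integral square matrix has a nonzero left kernel vector [c]; up to
    replacing [c] by its opposite, some coordinate is positive. *)
Lemma singular_relation n (G : 'I_n -> 'I_n -> int) (w : 'I_n -> int) :
  (exists j, w j != 0) -> (forall i, \sum_j G i j * w j = 0) ->
  exists2 c : 'I_n -> int, exists i, 0 < c i & forall j, \sum_i c i * G i j = 0.
Proof.
move=> [j0 wj0] Gw; pose B := \matrix_(i, j) G i j.
have detB : \det B == 0.
  rewrite -det_tr; apply/det0P; exists (\row_j w j).
    by apply/rV0Pn; exists j0; rewrite mxE.
  apply/rowP => i; rewrite !mxE -[RHS](Gw i); apply: eq_bigr => j _.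
  by rewrite !mxE mulrC.
have [c /rV0Pn[i0 ci0] cB] := det0P detB.
have cG j : \sum_i c 0 i * G i j = 0.
  move/rowP/(_ j): cB; rewrite !mxE => e; rewrite -[RHS]e.
  by apply: eq_bigr => i _; rewrite !mxE.
have [ci|ci|ci] := ltgtP 0 (c 0 i0); last by rewrite -ci eqxx in ci0.
  by exists (c 0) => //; exists i0.
exists (fun i => - c 0 i); first by exists i0; rewrite oppr_gt0.
move=> j; transitivity (- \sum_i c 0 i * G i j); last by rewrite cG oppr0.
by rewrite -sumrN; apply: eq_bigr => i _; rewrite mulNr.
Qed.

(** The functions dim Hom(X i, -) on the torsion class of [T] satisfy no
    nontrivial linear relation: this is the argument with the approximation
    [u : U -> X i0], its kernel [K] and the trace [N] of [T] in [K].  Applied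
    to [c] and to its opposite, the conclusion says that [c] is zero. *)
Lemma hom_dims_independent T n (X : 'I_n -> lmodType A) (c : 'I_n -> int) i0 :
  fin_gen T -> proj_dim_le1 T -> ext1_zero T T ->
  (forall i, indecomposable (X i) /\ is_summand (X i) T) ->
  (forall i j, isomorphic (X i) (X j) -> i = j) ->
  (forall Z, fin_gen Z -> ext1_zero T Z -> \sum_i c i * (hom_dim (X i) Z)%:Z = 0) ->
  c i0 <= 0.
Proof.
move=> Tf Tp TT Xi Xinj crel; rewrite leNgt; apply/negP => ci0.
have Xs i : is_summand (X i) T by case: (Xi i).
have Xind i : indecomposable (X i) by case: (Xi i).
have Xf i : fin_gen (X i).
  have [s [r rs]] := summandP (Xs i).
  by apply: (fin_gen_surj (f := r) Tf) => x; exists (s x).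
have TX i : ext1_zero T (X i).
  have [s [r rs]] := summandP (Xs i).
  by apply: (ext1_zero_surj (g := r) Tf Tp Tf _ TT) => x; exists (s x).
pose J : finType := {j | c j < 0}.
have Jf (j : J) : fin_gen (X (val j)) by [].
have [I [q [u uE]]] := @right_approximation _ _ J (fun j => X (val j)) (X i0) Jf (Xf i0).
pose U := prodm (fun i : I => X (val (q i))).
have Uf : fin_gen U by apply: prodm_fin_gen.
have TU : ext1_zero T U by apply: ext1_zero_prodm.
have [K [i [iI ui]]] := linear_kernel u.
have Kf : fin_gen K := fin_gen_submod Uf iI.
have [N [j [jI NT NE]]] := trace_submodule Tf Kf.
have Nf : fin_gen N := fin_gen_submod Kf jI.
have TN : ext1_zero T N := generated_ext1_zero Tf Tp TT NT.
have KN l : hom_dim (X l) N = hom_dim (X l) K.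
  have [s [r rs]] := summandP (Xs l); have [F FE] := hom_post (X l) j.
  apply: (kdim_bij (f := F) (homs_fin_gen (Xf l) Kf)); apply: inj_surj_bij.
    by move=> f h fh; apply: homsP => x; apply: jI; rewrite -!FE fh.
  move=> f; have [m mE] := NE ((f : {linear X l -> K}) \o r).
  exists (m \o s : {linear X l -> N}); apply: homsP => x.
  by rewrite FE /= mE /= rs.
(* [D l] is the codimension of the image of Hom(X l, U) -> Hom(X l, X i0). *)
pose D l : int := (hom_dim (X l) K)%:Z + (hom_dim (X l) (X i0))%:Z - (hom_dim (X l) U)%:Z.
have cD : \sum_l c l * D l = 0.
  have -> : \sum_l c l * D l = \sum_l c l * (hom_dim (X l) N)%:Z
      + \sum_l c l * (hom_dim (X l) (X i0))%:Z - \sum_l c l * (hom_dim (X l) U)%:Z.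
    rewrite -big_split -sumrB; apply: eq_bigr => l _.
    by rewrite KN /D mulrBr mulrDr.
  by rewrite !crel // addr0 subrr.
have lex l := hom_dim_left_exact (Xf l) Uf (Xf i0) iI ui.
have D0 l : 0 <= D l by rewrite subr_ge0 -PoszD lez_nat; case: (lex l).
have DJ l : c l < 0 -> D l = 0.
  move=> cl; apply/eqP; rewrite subr_eq0 -PoszD eqz_nat eq_sym; apply/eqP/(lex l).2.
  exact: (uE (exist _ l cl)).
have cD0 l : 0 <= c l * D l.
  by have [cl|cl] := leP 0 (c l); [exact: mulr_ge0|rewrite DJ ?mulr0].
have /eqP : c i0 * D i0 = 0 by apply: (psumr_eq0P (fun l _ => cD0 l) cD).
(* The identity of [X i0] lifts to a map [h : X i0 -> U]. *)
rewrite mulf_eq0 gt_eqF //= subr_eq0 -PoszD eqz_nat eq_sym => /eqP/(lex i0).2/(_ idfun)[h hE].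
pose b (p : I) : {linear X i0 -> X (val (q p))} := prodm_proj _ p \o h.
pose a (p : I) : {linear X (val (q p)) -> X i0} := u \o prodm_inj _ p.
pose ab p : homs (X i0) (X i0) := (a p \o b p : {linear X i0 -> X i0}).
have : bijective (\sum_p ab p).
  by exists id => x; rewrite homs_sumE -[RHS]hE (prodm_sum (h x)) linear_sum.
move=> /(local_sum (Xf i0) (Xind i0))[p abp].
have /Xinj e := indecomposable_factor (Xind i0) (Xind _) abp.
by have := valP (q p); rewrite -e ltNge (ltW ci0).
Qed.

(** The dimension vector of [W] is a nonzero vector in the kernel of the square
    matrix of the linear forms given by [hom_dim_linear]; the square shape is the
    equality between numbers of summands and of vertices.  A relation between the
    rows of this singular matrix contradicts [hom_dims_independent]. *)
Lemma tilting_orthogonal_zero T W : tilting #|Q| T -> fin_gen W ->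
  ext1_zero T W -> hom_zero T W -> is_zero_mod W.
Proof.
move=> [Tf Tp TT [X [Xi Xinj _]]] Wf TW0 TW; apply: contrapT => W0.
have Xs i : is_summand (X i) T by case: (Xi i).
have Xf i : fin_gen (X i).
  have [s [r rs]] := summandP (Xs i).
  by apply: (fin_gen_surj (f := r) Tf) => x; exists (s x).
have Xe i Z (TZ : ext1_zero T Z) : ext1_zero (X i) Z := ext1_zero_summand (Xs i) TZ.
have [g gE] := choice (fun i => hom_dim_linear (Xf i) (proj_dim_le1_summand (Xf i) Tp (Xs i) Tf)).
have [w [/(_ W0)[a0 wa0] wE]] := dim_vector_exists pres Wf.
have reindexQ (f : Q -> int) : \sum_a f a = \sum_(j < #|Q|) f (enum_val j).
  by rewrite -(big_enum_val (fun a => f a)).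
have [|i|c [i0 ci0] cG] := @singular_relation _ (fun i j => g i (enum_val j))
    (fun j => (w (enum_val j))%:Z).
- by exists (enum_rank a0); rewrite enum_rankK.
- rewrite -(reindexQ (fun a => g i a * (w a)%:Z)) -(gE i W) //; last exact: Xe.
  rewrite hom_dim_zero // => f x; have [s [r rs]] := summandP (Xs i).
  by rewrite -(rs x) -[f _]/((f \o r) _); apply: TW.
move: ci0; apply/negP; rewrite -leNgt.
apply: (@hom_dims_independent T _ X c i0 Tf Tp TT Xi Xinj) => Z Zf TZ.
have [z [_ zE]] := dim_vector_exists pres Zf.
transitivity (\sum_i \sum_(j < #|Q|) c i * (g i (enum_val j) * (z (enum_val j))%:Z)).
  apply: eq_bigr => i _; rewrite (gE i Z z) //; last exact: Xe.
  by rewrite reindexQ mulr_sumr.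
rewrite exchange_big big1 // => j _.
under eq_bigr => i _ do rewrite mulrA.
by rewrite -mulr_suml cG mul0r.
Qed.

(** The quotient of [X] by the trace of [T] is orthogonal to [T]: Ext^1(T, -) is
    right exact, and a map from [T] to the quotient lifts to [X], with image in
    the trace. *)
Lemma tilting_generated T X : tilting #|Q| T -> fin_gen X ->
  ext1_zero T X -> generated T X.
Proof.
move=> Tt Xf TX; have [Tf Tp TT _] := Tt.
have [N [j [jI NT NE]]] := trace_submodule Tf Xf.
have TN : ext1_zero T N := generated_ext1_zero Tf Tp TT NT.
have [Z [p [pS jp]]] := linear_cokernel j.
have Z0 : is_zero_mod Z.
  apply: (tilting_orthogonal_zero Tt (fin_gen_surj Xf pS)); first exact: ext1_zero_surj TX.
  move=> f t; have [g gE] := ext1_zero_lift (And3 jI pS jp) TN f.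
  by have [m mE] := NE g; rewrite -gE; apply/jp; exists (m t).
have [I [u uS]] := NT; exists I, (j \o u) => x.
have /jp[y <-] := Z0 (p x).
by have [z <-] := uS y; exists z.
Qed.

End TiltingTorsion.

(** * Powers of the radical *)
Section RadicalPowers.
Context {R : pzRingType}.
Implicit Types W X Y Z : lmodType R.

Lemma eq_radical X Y (f g : {linear X -> Y}) : f =1 g -> radical f -> radical g.
Proof.
move=> fg fr M Mf Mi h h' gB; apply: (fr M Mf Mi h h').
by apply: (eq_bij gB) => x; rewrite fg.
Qed.

Lemma eq_rad_pow n X Y (f g : {linear X -> Y}) : f =1 g -> rad_pow n f -> rad_pow n g.
Proof.
case: n => [|[|n]] //= fg; first exact: eq_radical.
by move=> [m [Z [h [h' [Zf hr h'r hE]]]]]; exists m, Z, h, h'; split=> // x; rewrite -fg.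
Qed.

Lemma radical_comp W X Y Z (h : {linear W -> X}) (f : {linear X -> Y}) (g : {linear Y -> Z}) :
  radical f -> radical (g \o (f \o h)).
Proof. by move=> fr M Mf Mi a b; apply: (fr M Mf Mi (h \o a) (b \o g)). Qed.

Lemma rad_pow_pre n W X Y (h : {linear W -> X}) (f : {linear X -> Y}) :
  rad_pow n f -> rad_pow n (f \o h).
Proof.
case: n => [|[|n]] //=; first exact: (@radical_comp _ _ _ _ h f idfun).
move=> [m [Z [a [b [Zf ar br fE]]]]]; exists m, Z, (fun i => a i \o h), b.
by split=> // i; exact: (@radical_comp _ _ _ _ h (a i) idfun).
Qed.

Lemma rad_pow_comp n m X Y Z (f : {linear X -> Y}) (g : {linear Y -> Z}) :
  fin_gen Y -> rad_pow n f -> rad_pow m g -> rad_pow (n + m) (g \o f).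
Proof.
move=> Yf; elim: n X f => [|[|n] IH] X f fr gr; first exact: rad_pow_pre.
  case: m {IH} gr => [|m] gr; first exact: (@radical_comp _ _ _ _ idfun f g).
  exists 1%N, (fun=> Y), (fun=> f), (fun=> g).
  by split=> // x; rewrite big_ord1.
have [p [W [a [b [Wf ar br fE]]]]] := fr.
exists p, W, a, (fun i => g \o b i); split=> // [i|x].
  exact: (IH _ (b i) (br i) gr).
by rewrite /= fE linear_sum.
Qed.

End RadicalPowers.

(** * Indecomposable summands *)
Section Decomposition.
Context {k : fieldType} {A : falgType k}.
Implicit Types K M X Y Z T : lmodType A.

Lemma not_indecomposable X : ~ is_zero_mod X -> ~ indecomposable X ->
  exists X1 X2, [/\ isomorphic X (X1 * X2)%type, ~ is_zero_mod X1 & ~ is_zero_mod X2].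
Proof.
move=> X0 Xi; apply: contrapT => no; apply: Xi; split=> // X1 X2 iso.
have [X10|X10] := pselect (is_zero_mod X1); first by left.
have [X20|X20] := pselect (is_zero_mod X2); first by right.
by case: no; exists X1, X2.
Qed.

(** A nonzero composite through [X] is the sum of the composites through the
    indecomposable summands of [X], one of which is therefore nonzero.  The
    decomposition is never formed: the induction passes to one of two proper
    direct summands, which has smaller dimension. *)
Lemma indecomposable_summand_through X Y Z (b : {linear Y -> X}) (a : {linear X -> Z}) y :
  fin_gen X -> a (b y) <> 0 ->
  exists (N : lmodType A) (s : {linear N -> X}) (r : {linear X -> N}),
    [/\ fin_gen N, indecomposable N & a (s (r (b y))) <> 0].
Proof.
have [n] := ubnP (kdim (resk X)); elim: n X b a => // n IH X b a Xn Xf ab.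
have X0 : ~ is_zero_mod X by move=> X0; apply: ab; rewrite (X0 (b y)) linear0.
have [Xi|Xi] := pselect (indecomposable X); first by exists X, idfun, idfun.
have [X1 [X2 [[f /linear_inverse[g [fK gK]]] X10 X20]]] := not_indecomposable X0 Xi.
have [i1 i1E] := linear_inl X1 X2; have [i2 i2E] := linear_inr X1 X2.
have f1S : surjective_hom (fst \o f) by move=> x; exists (g (x, 0)); rewrite /= gK.
have f2S : surjective_hom (snd \o f) by move=> x; exists (g (0, x)); rewrite /= gK.
have X1f := fin_gen_surj Xf f1S; have X2f := fin_gen_surj Xf f2S.
have ex : short_exact (g \o i1) (snd \o f).
  split=> // [x x' /= /(can_inj gK)|x /=]; first by rewrite !i1E => -[].
  split=> [fx|[x' <-]]; last by rewrite gK i1E.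
  by exists (f x).1; rewrite i1E -fx -surjective_pairing fK.
have pos Z' : fin_gen Z' -> ~ is_zero_mod Z' -> (0 < kdim (resk Z'))%N.
  by move=> /fin_gen_resk Zf Z0; rewrite lt0n; apply/eqP => /(kdim0P Zf).
have Xd := resk_short_exact_kdim X1f X2f ex.
have abE : a (b y) = a (g (i1 (f (b y)).1)) + a (g (i2 (f (b y)).2)).
  rewrite -linearD -linearD i1E i2E -[b y in LHS]fK; congr (a (g _)).
  by case: (f (b y)) => u w; congr pair; rewrite /= ?addr0 ?add0r.
have [e1|e1] := pselect (a (g (i1 (f (b y)).1)) = 0).
  have [||N [s [r [Nf Ni sr]]]] := IH X2 (snd \o f \o b) (a \o g \o i2) _ X2f.
  - by rewrite -ltnS; apply: leq_trans Xn; rewrite ltnS Xd -add1n leq_add2r; apply: pos.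
  - by move=> e2; apply: ab; rewrite abE e1 add0r.
  by exists N, (g \o i2 \o s), (r \o (snd \o f)).
have [||N [s [r [Nf Ni sr]]]] := IH X1 (fst \o f \o b) (a \o g \o i1) _ X1f.
- by rewrite -ltnS; apply: leq_trans Xn; rewrite ltnS Xd -addn1 leq_add2l; apply: pos.
- exact: e1.
by exists N, (g \o i1 \o s), (r \o (fst \o f)).
Qed.

End Decomposition.

(** * The contravariant functor D Hom(T, -) *)
Section DualHomFunctor.
Context {k : fieldType} {A : falgType k} (T : lmodType A).
Implicit Types X Y Z : lmodType A.

(** Hom(T, X) is a right module over the endomorphism ring of [T]; its dual is a
    left module. *)
Definition dual_hom X : Type := {linear homs T X -> k^o}.
HB.instance Definition _ X := gen_eqMixin (dual_hom X).
HB.instance Definition _ X := gen_choiceMixin (dual_hom X).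

Section Module.
Context (X : lmodType A).
Implicit Types p q r : dual_hom X.

Lemma dual_homP p q : (forall x, p x = q x) -> p = q.
Proof.
case: p q => [f [[fA] [fZ]]] [g [[gA] [gZ]]] /= /funext efg.
case: _ / efg in gA gZ *.
by rewrite (Prop_irrelevance gA fA) (Prop_irrelevance gZ fZ).
Qed.

Definition dual_hom_zero : dual_hom X := \0 : {linear homs T X -> k^o}.
Definition dual_hom_opp p : dual_hom X := \- (p : {linear homs T X -> k^o}) : {linear homs T X -> k^o}.
Definition dual_hom_add p q : dual_hom X :=
  (p : {linear homs T X -> k^o}) \+ (q : {linear homs T X -> k^o}) : {linear homs T X -> k^o}.

Definition hom_act (h : homs T X) (b : endring T) : homs T X :=
  (h : {linear T -> X}) \o (b : {linear T -> T}) : {linear T -> X}.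
Definition dual_hom_scale_fun (b : endring T) p (h : homs T X) : k^o := p (hom_act h b).
Fact dual_hom_scale_is_linear b p : linear (dual_hom_scale_fun b p).
Proof.
move=> c h h'; rewrite /dual_hom_scale_fun -linearP; congr (p _).
exact: homsP.
Qed.
HB.instance Definition _ b p := GRing.isLinear.Build k (homs T X) k^o *:%R
  (dual_hom_scale_fun b p) (dual_hom_scale_is_linear b p).
Definition dual_hom_scale b p : dual_hom X := dual_hom_scale_fun b p : {linear homs T X -> k^o}.

Fact dual_hom_addA : associative dual_hom_add.
Proof. by move=> f g h; apply: dual_homP => x; rewrite /= addrA. Qed.
Fact dual_hom_addC : commutative dual_hom_add.
Proof. by move=> f g; apply: dual_homP => x; rewrite /= addrC. Qed.
Fact dual_hom_add0 : left_id dual_hom_zero dual_hom_add.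
Proof. by move=> f; apply: dual_homP => x; rewrite /= add0r. Qed.
Fact dual_hom_addN : left_inverse dual_hom_zero dual_hom_opp dual_hom_add.
Proof. by move=> f; apply: dual_homP => x; rewrite /= addNr. Qed.
HB.instance Definition _ := GRing.isZmodule.Build (dual_hom X)
  dual_hom_addA dual_hom_addC dual_hom_add0 dual_hom_addN.
Fact dual_hom_scaleA b c p : dual_hom_scale b (dual_hom_scale c p) = dual_hom_scale (b * c) p.
Proof. by apply: dual_homP => h; congr (p _); apply: homsP. Qed.
Fact dual_hom_scale1 : left_id 1 dual_hom_scale.
Proof. by move=> p; apply: dual_homP => h; congr (p _); apply: homsP. Qed.
Fact dual_hom_scaleDr : right_distributive dual_hom_scale +%R.
Proof. by move=> b p q; apply: dual_homP. Qed.
Fact dual_hom_scaleDl p : {morph dual_hom_scale^~ p : b c / b + c}.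
Proof.
move=> b c; apply: dual_homP => h; rewrite /= /dual_hom_scale_fun -linearD; congr (p _).
by apply: homsP => t; rewrite homs_addE /= linearD.
Qed.
HB.instance Definition _ := GRing.Zmodule_isLmodule.Build (endring T) (dual_hom X)
  dual_hom_scaleA dual_hom_scale1 dual_hom_scaleDr dual_hom_scaleDl.

Lemma dual_hom_addE p q h : (p + q : dual_hom X) h = p h + q h. Proof. by []. Qed.
Lemma dual_hom_scaleE b p h : (b *: p : dual_hom X) h = p (hom_act h b). Proof. by []. Qed.
Lemma dual_hom_sumE (I : Type) (r : seq I) (P : pred I) (F : I -> dual_hom X) h :
  (\sum_(i <- r | P i) F i : dual_hom X) h = \sum_(i <- r | P i) F i h.
Proof. by elim/big_rec2: _ => // i y z _ <-. Qed.

(** The field acts on [dual_hom X] through the homotheties of [T]; so maps that are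
    linear over the endomorphism ring are linear over the field. *)
Definition end_scalar (c : k) : endring T :=
  homs_scale c (idfun : {linear T -> T}) : {linear T -> T}.

Lemma dual_hom_scalarE c p h : (end_scalar c *: p : dual_hom X) h = c * p h.
Proof.
rewrite dual_hom_scaleE -[c * _]/(c *: (p h : k^o)) -linearZ; congr (p _).
by apply: homsP => t; rewrite homs_scaleE /= /homs_scale_fun linearZ.
Qed.

Lemma dual_hom_dual_basis : fin_gen T -> fin_gen X ->
  exists n (h : 'I_n -> homs T X) (d : 'I_n -> dual_hom X),
    forall f, f = \sum_i (d i f : k) *: h i.
Proof.
move=> Tf Xf; have [beta [c cK betaK]] := kdimP (homs_fin_gen Tf Xf).
have [c' [cK' betaK']] : exists c' : {linear homs T X -> 'rV[k]_(kdim (homs T X))},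
    cancel beta c' /\ cancel c' beta by apply: linear_inverse; exists c.
have dL i : linear (fun f => c' f 0 i : k^o) by move=> a f g; rewrite linearP !mxE.
pose d i := projT1 (cid (linear_map_of (dL i))).
have dE i f : d i f = c' f 0 i by rewrite /d; case: cid.
exists _, (fun i => beta (delta_mx 0 i)), d => f.
rewrite -[LHS]betaK' [c' f]row_sum_delta linear_sum.
by apply: eq_bigr => i _; rewrite linearZ dE.
Qed.

Lemma dual_hom_expand n (h : 'I_n -> homs T X) (d : 'I_n -> dual_hom X) :
  (forall f, f = \sum_i (d i f : k) *: h i) ->
  forall p, p = \sum_i end_scalar (p (h i)) *: d i.
Proof.
move=> hd p; apply: dual_homP => f; rewrite dual_hom_sumE {1}(hd f) linear_sum.
by apply: eq_bigr => i _; rewrite linearZ dual_hom_scalarE mulrC.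
Qed.

Lemma dual_hom_fin_gen : fin_gen T -> fin_gen X -> fin_gen (dual_hom X).
Proof.
move=> Tf Xf; have [n [h [d hd]]] := dual_hom_dual_basis Tf Xf.
by exists n, d => p; exists (fun i => end_scalar (p (h i))); apply: dual_hom_expand.
Qed.

Lemma dual_hom_separates (f g : homs T X) : fin_gen T -> fin_gen X ->
  (forall p : dual_hom X, p f = p g) -> f = g.
Proof.
move=> Tf Xf fg; have [n [h [d hd]]] := dual_hom_dual_basis Tf Xf.
by rewrite (hd f) (hd g); apply: eq_bigr => i _; rewrite fg.
Qed.

End Module.

(** Evaluation of [psi] at [h] is a linear form on the dual of Hom(T, Y), hence the
    evaluation at an element of Hom(T, Y). *)
Lemma dual_hom_bidual X Y (psi : {linear dual_hom Y -> dual_hom X}) (h : homs T X) :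
  fin_gen T -> fin_gen Y -> exists f : homs T Y, forall p, psi p h = p f.
Proof.
move=> Tf Yf; have [n [b [d bd]]] := dual_hom_dual_basis Tf Yf.
exists (\sum_i (psi (d i) h : k) *: b i) => p.
rewrite {1}(dual_hom_expand bd p) linear_sum dual_hom_sumE linear_sum.
by apply: eq_bigr => i _; rewrite linearZ dual_hom_scalarE linearZ mulrC.
Qed.

Definition dual_hom_map_fun X Y (f : {linear X -> Y}) (p : dual_hom Y) : dual_hom X :=
  (p : {linear homs T Y -> k^o}) \o projT1 (cid (hom_post T f)) : {linear homs T X -> k^o}.

Lemma dual_hom_map_funE X Y (f : {linear X -> Y}) (p : dual_hom Y) (h : homs T X) :
  dual_hom_map_fun f p h = p (f \o (h : {linear T -> X}) : {linear T -> Y}).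
Proof.
rewrite /dual_hom_map_fun /=; case: cid => F FE /=; congr (p _).
by apply: homsP => t; rewrite FE.
Qed.

Fact dual_hom_map_is_linear X Y (f : {linear X -> Y}) : linear (dual_hom_map_fun f).
Proof.
move=> b p q; apply: dual_homP => h.
rewrite dual_hom_map_funE dual_hom_addE [in RHS]dual_hom_addE !dual_hom_scaleE !dual_hom_map_funE.
by congr (p _ + _); apply: homsP.
Qed.
HB.instance Definition _ X Y (f : {linear X -> Y}) := GRing.isLinear.Build (endring T)
  (dual_hom Y) (dual_hom X) *:%R (dual_hom_map_fun f) (dual_hom_map_is_linear f).
Definition dual_hom_map X Y (f : {linear X -> Y}) : {linear dual_hom Y -> dual_hom X} :=
  dual_hom_map_fun f.

Lemma dual_hom_mapE X Y (f : {linear X -> Y}) (p : dual_hom Y) (h : homs T X) :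
  dual_hom_map f p h = p (f \o (h : {linear T -> X}) : {linear T -> Y}).
Proof. exact: dual_hom_map_funE. Qed.

Lemma dual_hom_map_comp X Y Z (f : {linear X -> Y}) (g : {linear Y -> Z}) p :
  dual_hom_map (g \o f) p = dual_hom_map f (dual_hom_map g p).
Proof. by apply: dual_homP => h; rewrite !dual_hom_mapE; congr (p _); apply: homsP. Qed.

(** The dual separates the maps from [T], and these cover [X]. *)
Lemma dual_hom_map_faithful X Y (f g : {linear X -> Y}) :
  fin_gen T -> fin_gen Y -> generated T X ->
  (forall p, dual_hom_map f p = dual_hom_map g p) -> forall x, f x = g x.
Proof.
move=> Tf Yf [I [u uS]] fg x; have [z <-] := uS x.
rewrite (prodm_sum z) !linear_sum; apply: eq_bigr => i _.
have /(dual_hom_separates Tf Yf) : forall p : dual_hom Y,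
    p (f \o (u \o prodm_inj _ i) : {linear T -> Y}) = p (g \o (u \o prodm_inj _ i) : {linear T -> Y}).
  by move=> p; have := congr1 (fun q : dual_hom X => q (u \o prodm_inj _ i : {linear T -> X})) (fg p);
    rewrite !dual_hom_mapE.
by move=> /(congr1 (fun h : homs T Y => h (z i))).
Qed.

End DualHomFunctor.

(** * Transfer of radical morphisms to the endomorphism ring *)
Section Fullness.
Context {k : fieldType} {A : falgType k} {Q : quiver} (pres : bound_quiver A Q).
Context (T : lmodType A) (Tt : tilting #|Q| T).
Implicit Types X Y Z : lmodType A.

Let Tf : fin_gen T. Proof. by case: Tt. Qed.
Let Tp : proj_dim_le1 T. Proof. by case: Tt. Qed.
Let TT : ext1_zero T T. Proof. by case: Tt. Qed.

(** [X] has a presentation T^J -> T^I -> X -> 0 on which Hom(T, -) is exact: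
    [u : T^I -> X] is an approximation, surjective since [X] is generated by [T],
    and its kernel [K] is generated by [T] since Ext^1(T, K) = 0.  So [psi]
    applied to the components of [u] gives a map T^I -> Y vanishing on [K]. *)
Lemma hom_functor_full X Y (psi : homs T X -> homs T Y) :
  fin_gen X -> ext1_zero T X ->
  (forall h h', psi (h + h') = psi h + psi h') ->
  (forall h (b : endring T), psi (hom_act h b) = hom_act (psi h) b) ->
  exists f : {linear X -> Y}, forall h t, psi h t = f (h t).
Proof.
move=> Xf TX psiD psiM.
have psi0 : psi 0 = 0 by apply: (addrI (psi 0)); rewrite -psiD !addr0.
have [I0 [r0 [u uE]]] := @right_approximation _ _ unit (fun=> T) X (fun=> Tf) Xf.
have uS : surjective_hom u.
  have [I [v vS]] := tilting_generated pres Tt Xf TX.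
  move=> x; have [z <-] := vS x.
  have ex i := cid (uE tt (v \o prodm_inj _ i)).
  exists (\sum_i projT1 (ex i) (z i)).
  rewrite linear_sum {2}(prodm_sum z) linear_sum; apply: eq_bigr => i _.
  by rewrite (projT2 (ex i)).
pose h p : homs T X := (u \o prodm_inj (fun _ : I0 => T) p : {linear T -> X}).
have [F FE _] := prodm_copair (fun p : I0 => psi (h p) : {linear T -> Y}).
have psiu (m : {linear T -> prodm (fun _ : I0 => T)}) (g : homs T X) :
    (forall t, g t = u (m t)) -> forall t, psi g t = F (m t).
  move=> gE t; have -> : g = \sum_p hom_act (h p) (prodm_proj _ p \o m : {linear T -> T}).
    by apply: homsP => s; rewrite gE homs_sumE {1}(prodm_sum (m s)) linear_sum.
  rewrite (big_morph psi psiD psi0) homs_sumE FE.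
  by apply: eq_bigr => p _; rewrite psiM.
have [K [i [iI ui]]] := linear_kernel u.
have Kf : fin_gen K by apply: fin_gen_submod iI; apply: prodm_fin_gen.
have TK : ext1_zero T K.
  apply: (ext1_zero_kernel Tf Tp Kf iI ui (uE tt)).
  exact: ext1_zero_prodm.
have [I1 [w wS]] := tilting_generated pres Tt Kf TK.
have [f fE] : exists f : {linear X -> Y}, forall x, f (u x) = F x.
  apply: surj_factor => // x /ui[z <-]; have [y <-] := wS z.
  rewrite (prodm_sum y) !linear_sum big1 // => q _.
  rewrite -(psiu (i \o (w \o prodm_inj _ q)) 0) ?psi0 // => t.
  by rewrite homs_0E; apply/esym/ui; eexists.
exists f => g t; have [m mE] := uE tt g.
by rewrite (psiu m) -?fE ?mE.
Qed.

Lemma dual_hom_map_full X Y (psi : {linear dual_hom T Y -> dual_hom T X}) :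
  fin_gen X -> fin_gen Y -> ext1_zero T X ->
  exists f : {linear X -> Y}, forall p, psi p = dual_hom_map T f p.
Proof.
move=> Xf Yf TX.
have [phi phiE] := choice (fun h => dual_hom_bidual psi h Tf Yf).
have [||f fE] := @hom_functor_full X Y phi Xf TX.
- by move=> h h'; apply: (dual_hom_separates Tf Yf) => p; rewrite linearD -!phiE linearD.
- move=> h b; apply: (dual_hom_separates Tf Yf) => p.
  by rewrite -phiE -dual_hom_scaleE -linearZ phiE dual_hom_scaleE.
exists f => p; apply: dual_homP => h; rewrite dual_hom_mapE phiE; congr (p _).
by apply: homsP => t; rewrite fE.
Qed.

Definition torsion_indecomposable Y : Prop :=
  [/\ fin_gen Y, indecomposable Y & ext1_zero T Y].

(** If [dual_hom_map f] is not radical, it has a component that is an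
    automorphism of a nonzero module, and this yields a nonzero idempotent
    endomorphism of [dual_hom Y] of the form [dual_hom_map f] composed with some
    [psi].  By fullness [psi] comes from a map [f'], and by faithfulness
    [f' \o f] is a nonzero idempotent of the indecomposable module [Y], hence the
    identity; so [f] is not radical. *)
Lemma dual_hom_map_radical Y Z (f : {linear Y -> Z}) :
  torsion_indecomposable Y -> torsion_indecomposable Z ->
  radical f -> radical (dual_hom_map T f).
Proof.
move=> [Yf Yi TY] [Zf Zi TZ] fr M Mf [M0 _] h h' B.
have /linear_inverse[t [tK Kt]] : bijective (h' \o (dual_hom_map T f \o h)) by [].
have [f' f'E] := dual_hom_map_full (h \o (t \o h')) Zf Yf TZ.
have YG := tilting_generated pres Tt Yf TY.
have eE p : dual_hom_map T (f' \o f) p = dual_hom_map T f (h (t (h' p))).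
  by rewrite dual_hom_map_comp -f'E.
have ff : forall y, (f' \o f) y = idfun y.
  apply: idempotent_indecomposable => //.
    apply: (@dual_hom_map_faithful _ _ T _ _ ((f' \o f) \o (f' \o f)) (f' \o f)) => // p.
    rewrite (@dual_hom_map_comp _ _ T _ _ _ (f' \o f) (f' \o f)) !eE; congr (dual_hom_map T f (h _)).
    by rewrite -[LHS]/(t ((h' \o (dual_hom_map T f \o h)) (t (h' p)))) tK.
  apply: contrapT => e0; apply: M0 => m.
  have e0' p : dual_hom_map T (f' \o f) p = 0.
    apply: dual_homP => g; rewrite dual_hom_mapE -[RHS](linear0 p); congr (p _).
    by apply: homsP => x; apply: contrapT => ex; apply: e0; exists (g x).
  have Gm : dual_hom_map T f (h m) = 0.
    by have := e0' (dual_hom_map T f (h m)); rewrite eE -[h' _]/((h' \o (dual_hom_map T f \o h)) m) tK.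
  by rewrite -[m]tK /= Gm !linear0.
apply: (fr Y Yf Yi idfun f'); exists id => y; exact: ff.
Qed.

End Fullness.

Section Chains.
Context {k : fieldType} {A : falgType k} {Q : quiver} (pres : bound_quiver A Q).
Context (T : lmodType A) (Tt : tilting #|Q| T) (Ts : separating T).
Implicit Types P X Y Z : lmodType A.

(** A module in add T is a finite direct sum of direct summands of [T]. *)
Lemma add_closure_hom_zero P Y : add_closure T P -> hom_zero T Y -> hom_zero P Y.
Proof.
move=> PT TY; elim: {P} PT => [Z Z0|X Y' Z XT _ IH [f /linear_inverse[g [fK gK]]]] h z.
  by rewrite (Z0 z) linear0.
have [s [r rs]] := summandP XT.
have [i1 i1E] := linear_inl X Y'; have [i2 i2E] := linear_inr X Y'.
have -> : z = g (i1 (f z).1) + g (i2 (f z).2).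
  rewrite -linearD i1E i2E -[LHS]fK; congr (g _).
  by case: (f z) => u w; congr pair; rewrite /= ?addr0 ?add0r.
rewrite linearD -[X in _ + X]/((h \o (g \o i2)) (f z).2) IH addr0.
by rewrite -(rs (f z).1) -[LHS]/((h \o (g \o (i1 \o r))) (s (f z).1)) TY.
Qed.

(** Induction on the number of radical factors: a nonzero summand of the sum
    defining [rad_pow n f] starts with a radical map [h i], and one can pass to an
    indecomposable summand of its target while keeping a nonzero value at [p].
    That summand receives a nonzero map from [P], so it is not in F(T), and is in
    T(T) as [T] is separating.  The bound [m <= n] spares the inclusion of
    [rad_pow n] in [rad_pow m]: exceeding factors are dropped from the end of the
    chain, which keeps the value at [p] nonzero. *)
Lemma radical_chain P n X Y (a : {linear P -> Y}) (f : {linear Y -> X}) p :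
  add_closure T P -> torsion_indecomposable T Y -> fin_gen X ->
  rad_pow n f -> f (a p) <> 0 ->
  forall m, (m <= n)%N -> exists Z (b : {linear Y -> Z}),
    [/\ torsion_indecomposable T Z, b (a p) <> 0 & rad_pow m (dual_hom_map T b)].
Proof.
move=> PT; have [Tf _ _ _] := Tt.
have good Z (c : {linear P -> Z}) : fin_gen Z -> indecomposable Z -> c p <> 0 ->
    torsion_indecomposable T Z.
  move=> Zf Zi cp; split=> //; have [//|TZ] := Ts Zf Zi.
  by case: cp; apply: (add_closure_hom_zero PT TZ).
elim: n X Y a f => [|n IH] X Y a f Yg Xf fr fap m.
  rewrite leqn0 => /eqP->; exists Y, idfun; split=> //= ap.
  by apply: fap; rewrite ap linear0.
case: m => [_|m mn].
  by exists Y, idfun; split=> //= ap; apply: fap; rewrite ap linear0.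
case: n IH fr mn => [|n] IH fr mn.
  have [N [s [r [Nf Ni sr]]]] := indecomposable_summand_through (b := f \o a) (a := idfun) Xf fap.
  have rfa : r (f (a p)) <> 0 by move=> e; apply: sr; rewrite /= e linear0.
  have Ng := good N (r \o (f \o a)) Nf Ni rfa.
  exists N, (r \o f); split=> //; move: mn; rewrite ltnS leqn0 => /eqP->.
  apply: (dual_hom_map_radical pres Tt Yg Ng).
  exact: (@radical_comp _ _ _ _ _ idfun f r).
have [q [W [h [g [Wf hr gr fE]]]]] := fr.
have [i gh] : exists i, g i (h i (a p)) <> 0.
  apply: contrapT => no; apply: fap; rewrite fE big1 // => i _.
  by apply: contrapT => gh; apply: no; exists i.
have [N [s [r [Nf Ni sr]]]] :=
  indecomposable_summand_through (b := h i \o a) (a := g i) (Wf i) gh.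
have rha : r (h i (a p)) <> 0 by move=> e; apply: sr; rewrite /= e linear0 linear0.
pose b := r \o h i.
have Ng := good N (b \o a) Nf Ni rha.
have gsr : rad_pow n.+1 (g i \o s) by apply: rad_pow_pre; apply: gr.
have [Z [c [Zg cb cr]]] := IH X N (b \o a) (g i \o s) Ng Xf gsr sr m mn.
exists Z, (c \o b); split=> //.
apply: (@eq_rad_pow _ _ _ _ (dual_hom_map T b \o dual_hom_map T c)).
  by move=> x; rewrite dual_hom_map_comp.
rewrite -addn1; apply: rad_pow_comp cr _; first by apply: dual_hom_fin_gen.
apply: (dual_hom_map_radical pres Tt Yg Ng).
exact: (@radical_comp _ _ _ _ _ idfun (h i) r).
Qed.

Lemma radical_length_transfer P X (f : {linear P -> X}) n m p :
  fin_gen P -> add_closure T P -> fin_gen X -> rad_pow n f -> f p <> 0 ->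
  (m <= n)%N -> ~ rad_pow_zero (endring T) m.
Proof.
move=> Pf PT Xf fr fp mn B0.
have [N [s [r [Nf Ni sr]]]] := indecomposable_summand_through (b := idfun) (a := f) Pf fp.
have Ng : torsion_indecomposable T N.
  split=> //; have [//|TN] := Ts Nf Ni.
  by case: sr; rewrite /= (add_closure_hom_zero PT TN r) !linear0.
have [Z [b [[Zf Zi TZ] bp br]]] :=
  radical_chain (a := r) (f := f \o s) PT Ng Xf (rad_pow_pre s fr) sr mn.
have [Tf _ _ _] := Tt; have [_ _ TN] := Ng.
apply: bp; rewrite (@dual_hom_map_faithful _ _ T _ _ b \0) //.
  exact: (tilting_generated pres).
move=> q; rewrite (B0 _ _ (dual_hom_map T b)) //; try exact: dual_hom_fin_gen.
by apply: dual_homP => h; rewrite dual_hom_mapE -[LHS](linear0 q); congr (q _); apply: homsP.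
Qed.

End Chains.

(** * A deep morphism out of a projective module *)
Section DegreeBounds.
Context {R : pzRingType}.
Implicit Types X Y Z : lmodType R.

Lemma leastP (P : nat -> Prop) n : least P = Some n -> forall d, P d -> (n <= d)%N.
Proof.
rewrite /least; case: pselect => // ex [<-] d Pd.
by case: ex_minnP => m _; apply; apply/asboolP.
Qed.

Lemma depth_exists X Y (f : {linear X -> Y}) n :
  ~ rad_pow n f -> exists2 d, has_depth f d & (d < n)%N.
Proof.
elim: n => [|n IH] fn; first by case: fn.
have [fn'|/IH[d fd dn]] := pselect (rad_pow n f); first by exists n.
by exists d => //; apply: ltnW.
Qed.

Lemma rad_pow_null n X Y (f : {linear X -> Y}) : (forall x, f x = 0) -> rad_pow n.+2 f.
Proof.
move=> f0; exists 0%N, (fun=> X), (fun=> idfun), (fun=> f).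
by split=> [[]|[]|[]|x] //; rewrite big_ord0.
Qed.

(** If the depth [d] of [g] were smaller than the degree [n], then [g], whose
    composite with [f] is zero and thus lies in every power of the radical, would
    contradict the minimality of [n]. *)
Lemma right_degree_rad_pow X Y Z (f : {linear X -> Y}) (g : {linear Y -> Z}) n :
  right_degree f = Some n -> fin_gen Z -> (forall x, g (f x) = 0) -> rad_pow n g.
Proof.
move=> /leastP min Zf gf; apply: contrapT => /depth_exists[d gd].
rewrite ltnNge => /negP; apply; apply: min; exists Z, g; split=> //.
exact: rad_pow_null.
Qed.

Lemma left_degree_rad_pow X Y Z (f : {linear X -> Y}) (g : {linear Z -> X}) n :
  left_degree f = Some n -> fin_gen Z -> (forall x, f (g x) = 0) -> rad_pow n g.
Proof.
move=> /leastP min Zf fg; apply: contrapT => /depth_exists[d gd].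
rewrite ltnNge => /negP; apply; apply: min; exists Z, g; split=> //.
exact: rad_pow_null.
Qed.

End DegreeBounds.

(** Trivial paths have length less than 2, so their values are linearly
    independent, and in particular nonzero. *)
Lemma bq_e_neq0 (k : fieldType) (A : falgType k) (Q : quiver)
    (pres : bound_quiver A Q) (u : Q) :
  bq_e pres u != 0.
Proof.
apply/eqP => e0; pose q : qpath Q := exist (fun p : Q * seq (arrow Q) => is_path p.1 p.2) (u, [::]) isT.
have := @bq_le _ _ _ pres [:: q] (fun=> 1) isT.
rewrite big_seq1 /path_eval /= e0 scaler0 => /(_ erefl q); rewrite mem_head => /(_ isT isT)/eqP.
by rewrite oner_eq0.
Qed.

Section VertexMap.
Context {k : fieldType} {A : falgType k}.
Implicit Types X Y Z M : lmodType A.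

(** A proper submodule of maximal dimension is maximal. *)
Lemma maximal_submod_exists M : fin_gen M -> ~ is_zero_mod M ->
  exists N : submodClosed M, maximal_submod N.
Proof.
move=> Mf M0.
pose C d := `[< exists N : submodClosed M,
  (exists x, x \notin N) /\ kdim (resk (submod N)) = d >].
have kd (N : submodClosed M) : (kdim (resk (submod N)) <= kdim (resk M))%N.
  have [i iE] := resk_map (submod_incl N).
  apply: (kdim_inj (f := i) ((fin_gen_resk _).1 Mf)) => x y; rewrite !iE.
  exact: (@submod_incl_inj _ _ N).
have exC : exists d, C d.
  have [N NE] : exists N : submodClosed M, forall x, x \in N <-> x = 0.
    apply: submod_of => // a x y -> ->; by rewrite scaler0 addr0.
  exists (kdim (resk (submod N))); apply/asboolP; exists N; split=> //.
  apply: contrapT => no; apply: M0 => x; apply/NE; apply: contrapT => /negP xN.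
  by apply: no; exists x.
have Cb d : C d -> (d <= kdim (resk M))%N by move=> /asboolP[N [_ <-]].
case: (ex_maxnP exC Cb) => d /asboolP[N [Nx Nd]] dmax.
exists N; split=> // N' NN'; have [all|no] := pselect (forall x, x \in N'); first by right.
left=> x xN'.
have /dmax le : C (kdim (resk (submod N'))).
  apply/asboolP; exists N'; split=> //; apply: contrapT => no'; apply: no => y.
  by apply: contrapT => /negP yN; apply: no'; exists y.
have [h hE] : exists h : {linear submod N -> submod N'}, forall z,
    submod_incl N' (h z) = submod_incl N z.
  by apply: corestrict => z; apply: NN'; apply: submod_inclP.
have N'f : fin_gen (submod N') by apply: fin_gen_submod Mf (@submod_incl_inj _ _ N').
have hI : injective h.
  by move=> y z e; apply: (@submod_incl_inj _ _ N); rewrite -!hE e.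
have hS : surjective_hom h by apply: module_inj_surj => //; rewrite Nd.
have [y <-] := submod_incl_surj xN'; have [z <-] := hS y.
by rewrite hE submod_inclP.
Qed.

(** The image of a nonzero map from a simple module is simple. *)
Lemma image_in_socle M (N : submodClosed M) X (j : {linear quotmod N -> X}) :
  maximal_submod N -> (exists z, j z <> 0) -> forall z, j z \in socm X.
Proof.
move=> [_ Nmax] [z0 jz0] z.
have [J JE] : exists J : submodClosed X, forall x, x \in J <-> exists z, j z = x.
  apply: submod_of; first by exists 0; rewrite linear0.
  by move=> a _ _ [x <-] [y <-]; exists (a *: x + y); rewrite linearP.
apply/asboolP; exists 1%N, (fun=> j z); split; last by rewrite big_ord1.
move=> _; exists J; last by apply/JE; exists z.
split; first by exists (j z0); [apply/JE; exists z0|apply/eqP].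
move=> J' J'J; pose p := quotmod_proj N.
have [L LE] : exists L : submodClosed M, forall x, x \in L <-> j (p x) \in J'.
  apply: submod_of; first by rewrite !linear0 rpred0.
  by move=> a x y xL yL; rewrite !linearP /= rpredD // rpredZ.
have pS : surjective_hom p := @quotmod_proj_surj _ _ N.
have [x xN|LN|LT] := Nmax L.
- by apply/LE; rewrite (quotmod_proj0 _ _).2 // linear0 rpred0.
- left=> x xJ'; have /JE[y yE] := J'J x xJ'; have [w wE] := pS y.
  have /LN/(quotmod_proj0 _ _).2 w0 : w \in L by apply/LE; rewrite wE yE.
  by rewrite -yE -wE w0 linear0.
by right=> x /JE[y <-]; have [w <-] := pS y; apply/LE.
Qed.

Lemma functional_exists (V : lmodType k) (x : V) : fin_gen V -> x <> 0 ->
  exists f : {linear V -> k^o}, f x <> 0.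
Proof.
move=> /kdimP[b bB] x0; have [c [cK Kc]] := linear_inverse bB.
have [i ci] : exists i, c x 0 i <> 0.
  apply: contrapT => no; apply: x0; rewrite -[x]Kc -[RHS](linear0 b); congr (b _).
  by apply/rowP => i; rewrite mxE; apply: contrapT => ci; apply: no; exists i.
have fL : linear (fun y => c y 0 i : k^o) by move=> a y z; rewrite linearP !mxE.
by have [f fE] := linear_map_of fL; exists f; rewrite fE.
Qed.

Context (e : A) (e0 : e != 0) (ee : e * e = e).

Lemma regular_fin_gen : fin_gen (A^o : lmodType A).
Proof.
exists 1%N, (fun=> 1) => x; exists (fun=> x); rewrite big_ord1.
exact: (esym (mulr1 (x : A))).
Qed.

Lemma projm_fin_gen : fin_gen (projm e).
Proof. exact: fin_gen_submod regular_fin_gen (@submod_incl_inj _ _ _). Qed.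

(** The adjunction Hom_A(X, D(eA)) = D(eX), for a functional given on all of [X]. *)
Lemma injm_map X (phi : {linear resk X -> k^o}) :
  exists j : {linear X -> injm e}, forall x (u : subvs_of (right_ideal e)),
    (j x : injm_type e) u = phi (vsval u *: x : X).
Proof.
have uL x : linear (fun u : subvs_of (right_ideal e) => phi (vsval u *: x : X)).
  move=> c u w; rewrite -linearP; congr (phi _).
  by rewrite resk_scaleE linearP scalerDl scalerA mulr_algl.
pose j x : injm e := linfun (projT1 (cid (linear_map_of (uL x)))).
have jE x u : (j x : injm_type e) u = phi (vsval u *: x : X).
  by rewrite /j lfunE; case: cid.
have jL : linear j.
  move=> a x y; apply/lfunP => u.
  transitivity (injm_scale a (j x) u + (j y : injm_type e) u); last exact/esym/add_lfunE.
  rewrite injm_scaleE !jE -linearD; congr (phi _).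
  by rewrite scalerDr scalerA.
by have [j' j'E] := linear_map_of jL; exists j' => x u; rewrite j'E jE.
Qed.

Lemma injm_fin_gen : fin_gen (injm e).
Proof.
pose b := vbasis {:injm_type e}.
have scalE (c : k) (h : injm_type e) : injm_scale c%:A h = c *: h.
  apply/lfunP => u; rewrite injm_scaleE scale_lfunE -linearZ; congr (h _).
  by apply: val_inj; rewrite /= mulr_algr.
exists (\dim {:injm_type e}), (fun i => b`_i : injm e) => h.
exists (fun i => (coord b i h)%:A).
rewrite [LHS](coord_vbasis (memvf (h : injm_type e))); apply: eq_bigr => i _.
exact/esym/scalE.
Qed.

(** The morphism is the composite of the projection of [projm e] onto a simple
    quotient and of a nonzero map [j] from it to [injm e].  The projection kills
    the radical of [projm e] because that is contained in every maximal submodule;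
    the image of [j] is simple, hence in the socle.  The minimality of the two
    degrees gives the two depths.  When [projm e] or [injm e] is [simplem e], the number
    replacing the degree is 0, and every morphism is in the power 0. *)
Lemma deep_vertex_morphism n : r_vertex e = Some n ->
  exists X (f : {linear projm e -> X}) p, [/\ fin_gen X, rad_pow n f & f p <> 0].
Proof.
rewrite /r_vertex /addoo; case nE: (n_vertex e) => [n1|] //; case mE: (m_vertex e) => [n2|] // [<-].
have eP : (e : A^o) \in left_ideal e.
  by apply/memv_cosetP; exists 1; rewrite ?memvf ?mul1r.
(* [g] is [e] as an element of [projm e], which it generates. *)
have [g gE] := submod_incl_surj (N := left_ideal e) eP.
have gI := @submod_incl_inj _ _ (left_ideal e).
have eg : e *: g = g by apply: gI; rewrite linearZ gE.
have gen (x : projm e) : exists a, x = a *: g.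
  have /memv_cosetP[a _ aE] := submod_inclP x.
  by exists a; apply: gI; rewrite linearZ gE.
have P0 : ~ is_zero_mod (projm e).
  by move=> P0; move/eqP: e0; apply; rewrite -gE (P0 g) linear0.
have [N Nmax] := maximal_submod_exists projm_fin_gen P0.
pose p := quotmod_proj N; have pS : surjective_hom p := @quotmod_proj_surj _ _ N.
have Zf := fin_gen_surj projm_fin_gen pS.
have pg : p g <> 0.
  move=> /quotmod_proj0 gN; have [[x /negP]] := Nmax; case.
  by have [a ->] := gen x; rewrite rpredZ.
have [phi phig] := functional_exists ((fin_gen_resk _).1 Zf) pg.
have [j jE] := injm_map phi.
have jpg : j (p g) <> 0.
  have eR : e \in right_ideal e.
    have := memv_mul (memv_line e) (memvf (1 : A)); by rewrite mulr1.
  move=> /(congr1 (fun h : injm_type e => h (Subvs eR))).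
  rewrite jE /= zero_lfunE => e1; apply: phig; rewrite -[RHS]e1; congr (phi _).
  by rewrite -[p g in LHS](congr1 p eg) linearZ.
exists (injm e), (j \o p), g; split=> //.
  exact: injm_fin_gen.
apply: rad_pow_comp => //.
  move: nE; rewrite /n_vertex; case: asboolP => [_ [<-] //|_ nd].
  apply: (right_degree_rad_pow nd Zf) => x; apply/quotmod_proj0.
  have /asboolP := submod_inclP x; exact.
move: mE; rewrite /m_vertex; case: asboolP => [_ [<-] //|_ md].
apply: (left_degree_rad_pow md Zf) => x; apply/quotmod_proj0.
by apply: (image_in_socle Nmax); exists (p g).
Qed.

End VertexMap.

Theorem theoremA (k : closedFieldType) (A : falgType k)
    (Q : quiver) (pres : bound_quiver A Q) (T : lmodType A) (rA rB : nat) :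
  rep_finite A ->
  tilting #|vertex Q| T ->
  separating T ->
  nilpotency_index A rA ->
  rep_finite (endring T) ->
  nilpotency_index (endring T) rB ->
  (exists u : vertex Q,
      r_vertex (bq_e pres u) = Some (rA - 1)%N /\
      add_closure T (projm (bq_e pres u))) ->
  (rA <= rB)%N.
Proof.
move=> _ Tt Ts _ _ [_ B0 _] [u [ru uT]].
rewrite leqNgt; apply/negP => lt.
have ee : bq_e pres u * bq_e pres u = bq_e pres u by rewrite bq_orth eqxx.
have [X [f [p [Xf fr fp]]]] := deep_vertex_morphism (bq_e_neq0 pres u) ee ru.
apply: (radical_length_transfer pres Tt Ts (projm_fin_gen _) uT Xf fr fp _ B0).
by rewrite -ltnS subn1 prednK //; apply: leq_trans lt.
Qed.
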